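(* Let $L=L_1\sqcup\dots\sqcup L_m$ be a split link, where $L_1,\dots,L_m$ are links, and let $L=\widehat{\alpha}$ with $\alpha=\alpha_1\cdots\alpha_m\in B_n$, where for some integers $0=i_0<1\le i_1<\dots<i_m=n$ with $i_{j+1}-i_j>1$ for $1\le j\le m-1$, each $\alpha_j$ belongs to the subgroup of $B_{i_j}$ generated by $\sigma_{i_{j-1}+1},\dots,\sigma_{i_j-1}$ and its closure as an element of $B_{i_j}$ is the split union of $L_j$ with $i_{j-1}$ unknots. Then $$\mathrm{tr}_d(\alpha)=\mathrm{tr}_d(\alpha_1)\cdots\mathrm{tr}_d(\alpha_m),$$ and consequently, for every non-empty subset $D\subseteq\mathbb{Z}/d\mathbb{Z}$, $$\mathrm{tr}_{d,D}(\alpha)=\mathrm{tr}_{d,D}(\alpha_1)\cdots\mathrm{tr}_{d,D}(\alpha_m).$$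
   Context: Let $d\in\mathbb{N}$. $\widehat{\alpha}$ denotes the closure of a braid $\alpha$. Framed braid group: $\mathcal{F}_n\cong\mathbb{Z}^n\rtimes B_n$ is generated by the braid generators $\sigma_1,\dots,\sigma_{n-1}$ of $B_n$ and framing generators $t_1,\dots,t_n$, with the braid relations, $t_it_j=t_jt_i$ and $t_j\sigma_i=\sigma_it_{s_i(j)}$, $s_i=(i,i+1)$. $\mathcal{F}_{d,n}$ is the quotient by $t_j^d=1$ for all $j$; put $e_i:=\frac1d\sum_{s=1}^{d}t_i^st_{i+1}^{-s}\in\mathbb{C}\mathcal{F}_{d,n}$. Yokonuma--Hecke algebra: for fixed $q\in\mathbb{C}\setminus\{0\}$, $\mathrm{Y}_{d,n}(q)$ is the quotient of $\mathbb{C}\mathcal{F}_{d,n}$ by the ideal generated by $\sigma_i^2-1-(q-q^{-1})e_i\sigma_i$; $g_i$ is the image of $\sigma_i$. There are natural inclusions $\mathrm{Y}_{d,n}(q)\subset\mathrm{Y}_{d,n+1}(q)$. Trace: for indeterminates $z,x_1,\dots,x_{d-1}$, $\mathrm{tr}_d:\bigcup_{n\ge0}\mathrm{Y}_{d,n}(q)\to\mathbb{C}[z,x_1,\dots,x_{d-1}]$ is the unique linear map (Juyumaya) with $\mathrm{tr}_d(ab)=\mathrm{tr}_d(ba)$, $\mathrm{tr}_d(1)=1$, $\mathrm{tr}_d(ag_n)=z\,\mathrm{tr}_d(a)$, $\mathrm{tr}_d(at_{n+1}^s)=x_s\,\mathrm{tr}_d(a)$ ($1\le s\le d-1$) for all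 $n$ and $a,b\in\mathrm{Y}_{d,n}(q)$. For a braid $\alpha\in B_n$, $\mathrm{tr}_d(\alpha)$ means $\mathrm{tr}_d$ of its image under $\sigma_i\mapsto g_i$. Specialized trace: the E-system is the system $E^{(m)}=x_mE$ ($1\le m\le d-1$) over $\mathbb{C}$, where $E^{(m)}=\frac1d\sum_{s=0}^{d-1}x_{m+s}x_{d-s}$, $E=E^{(0)}$, indices mod $d$, $x_0=1$. Its solutions are parametrized (Gérardin) by the non-empty subsets $D\subseteq\mathbb{Z}/d\mathbb{Z}$: the solution $X_D=(\mathrm{x}_1,\dots,\mathrm{x}_{d-1})$ is $\mathrm{x}_k=\frac1{|D|}\sum_{m\in D}\exp(2\pi km\sqrt{-1}/d)$. $\mathrm{tr}_{d,D}:\bigcup_n\mathrm{Y}_{d,n}(q)\to\mathbb{C}[z]$ is $\mathrm{tr}_d$ with the parameters $(x_1,\dots,x_{d-1})$ specialized to $X_D$. *)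

(* Defs.v *)
From HB Require Import structures.
From mathcomp Require Import all_boot all_order all_algebra.
From mathcomp Require Import perm generic_quotient finmap.
From mathcomp Require Import all_classical all_reals all_analysis.
From mathcomp Require Import complex.
From mathcomp Require Import (canonicals) monalg.
From mathcomp Require Import -(notations) mpoly.

Set Implicit Arguments.
Unset Strict Implicit.
Unset Printing Implicit Defensive.

Import GRing.Theory Num.Theory.
Import numFieldNormedType.Exports.

Local Open Scope classical_set_scope.
Local Open Scope ring_scope.
Local Open Scope quotient_scope.

(** * Groups given by generators and relations *)

(* The letter (a, true) is the generator a, and (a, false) is its inverse. *)
Definition word (A : Type) := seq (A * bool).

Definition inv_word (A : Type) (w : word A) : word A :=
  rev [seq (x.1, ~~ x.2) | x <- w].

Definition map_word (A B : Type) (f : A -> B) (w : word A) : word B :=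
  [seq (f x.1, x.2) | x <- w].

Section Presentation.
Context (A : choiceType) (rel : word A -> word A -> Prop).

Inductive word_eq : word A -> word A -> Prop :=
| word_eq_refl u : word_eq u u
| word_eq_sym u v : word_eq u v -> word_eq v u
| word_eq_trans v u w : word_eq u v -> word_eq v w -> word_eq u w
| word_eq_cat u u' v v' :
    word_eq u u' -> word_eq v v' -> word_eq (u ++ v) (u' ++ v')
| word_eq_cancel a e : word_eq [:: (a, e); (a, ~~ e)] [::]
| word_eq_rel u v : rel u v -> word_eq u v.

Definition word_eqb (u v : word A) : bool := `[< word_eq u v >].

Lemma word_eqb_equiv : equiv_class_of word_eqb.
Proof.
split=> [u | u v | v u w].
- exact/asboolP/word_eq_refl.
- by apply/asboolP/asboolP; apply: word_eq_sym.
- by move=> /asboolP uv /asboolP vw; apply/asboolP; apply: word_eq_trans vw.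
Qed.

Canonical word_equiv := EquivRelPack word_eqb_equiv.

Definition presented : Type := {eq_quot word_equiv}.
HB.instance Definition _ := Choice.on presented.
HB.instance Definition _ := EqQuotient.on presented.

Definition class_of_word (w : word A) : presented := \pi_presented%qT w.

Lemma class_of_wordP u v : class_of_word u = class_of_word v <-> word_eq u v.
Proof.
split; first by move/eqquotP => /asboolP.
by move=> uv; apply/eqquotP/asboolP.
Qed.

Lemma class_of_wordK x : class_of_word (repr x) = x.
Proof. exact: reprK. Qed.

Lemma inv_word_cat (u v : word A) :
  inv_word (u ++ v) = inv_word v ++ inv_word u.
Proof. by rewrite /inv_word map_cat rev_cat. Qed.

Lemma inv_wordK : involutive (@inv_word A).
Proof.
move=> u; rewrite /inv_word map_rev revK -map_comp map_id_in // => -[a e] _.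
by rewrite /= negbK.
Qed.

Lemma word_eq_mulV (u : word A) : word_eq (u ++ inv_word u) [::].
Proof.
elim: u => [|[a e] u IHu]; first exact: word_eq_refl.
rewrite -cat1s inv_word_cat -catA [u ++ _]catA.
apply: word_eq_trans (word_eq_cancel a e).
apply: (@word_eq_cat [:: (a, e)] [:: (a, e)] _ [:: (a, ~~ e)]).
  exact: word_eq_refl.
apply: (@word_eq_cat _ [::] _ [:: (a, ~~ e)]) => //; exact: word_eq_refl.
Qed.

Lemma word_eq_mulVl (u : word A) : word_eq (inv_word u ++ u) [::].
Proof. by have := word_eq_mulV (inv_word u); rewrite inv_wordK. Qed.

Lemma word_eq_inv u v : word_eq u v -> word_eq (inv_word u) (inv_word v).
Proof.
move=> uv; have W := word_eq_refl.
have h1 : word_eq (inv_word u ++ v ++ inv_word v) (inv_word u).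
  rewrite -[X in word_eq _ X]cats0.
  exact: word_eq_cat (W _) (word_eq_mulV v).
have h2 : word_eq (inv_word u ++ v ++ inv_word v) (inv_word v).
  rewrite catA; apply: (@word_eq_cat _ [::]); last exact: W.
  apply: word_eq_trans (word_eq_mulVl u).
  exact: word_eq_cat (W _) (word_eq_sym uv).
exact: word_eq_trans (word_eq_sym h1) h2.
Qed.

Definition presented_one : presented := class_of_word [::].
Definition presented_mul (x y : presented) : presented :=
  class_of_word (repr x ++ repr y).
Definition presented_inv (x : presented) : presented :=
  class_of_word (inv_word (repr x)).

Lemma word_eq_repr u : word_eq (repr (class_of_word u)) u.
Proof. by apply/class_of_wordP; rewrite class_of_wordK. Qed.

Lemma presented_mulE u v :
  presented_mul (class_of_word u) (class_of_word v) = class_of_word (u ++ v).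
Proof. by apply/class_of_wordP/word_eq_cat; apply: word_eq_repr. Qed.

Lemma presented_invE u :
  presented_inv (class_of_word u) = class_of_word (inv_word u).
Proof. by apply/class_of_wordP/word_eq_inv; apply: word_eq_repr. Qed.

Lemma presented_mulA : associative presented_mul.
Proof.
move=> x y z; rewrite -(class_of_wordK x) -(class_of_wordK y).
by rewrite -(class_of_wordK z) !presented_mulE catA.
Qed.

Lemma presented_mul1 : left_id presented_one presented_mul.
Proof. by move=> x; rewrite -(class_of_wordK x) presented_mulE. Qed.

Lemma presented_mulr1 : right_id presented_one presented_mul.
Proof. by move=> x; rewrite -(class_of_wordK x) presented_mulE cats0. Qed.

Lemma presented_mulV : left_inverse presented_one presented_inv presented_mul.
Proof.
move=> x; rewrite -(class_of_wordK x) presented_invE presented_mulE.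
exact/class_of_wordP/word_eq_mulVl.
Qed.

Lemma presented_mulrV : right_inverse presented_one presented_inv presented_mul.
Proof.
move=> x; rewrite -(class_of_wordK x) presented_invE presented_mulE.
exact/class_of_wordP/word_eq_mulV.
Qed.

HB.instance Definition _ := isGroup.Build presented
  presented_mulA presented_mul1 presented_mulr1 presented_mulV presented_mulrV.

Lemma class_of_word_cat u v :
  class_of_word (u ++ v) = (class_of_word u * class_of_word v)%g.
Proof. by rewrite -presented_mulE. Qed.

Definition pgen (a : A) : presented := class_of_word [:: (a, true)].

End Presentation.

(* The homomorphism induced by a map f of generators.  It is meaningful when f
   maps relations to relations: see [presented_mapE]. *)
Section PresentedMap.
Context (A B : choiceType) (f : A -> B).
Context (relA : word A -> word A -> Prop) (relB : word B -> word B -> Prop).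

Definition presented_map (x : presented relA) : presented relB :=
  class_of_word relB (map_word f (repr x)).

Hypothesis f_rel : forall u v, relA u v ->
  word_eq relB (map_word f u) (map_word f v).

Lemma word_eq_map u v :
  word_eq relA u v -> word_eq relB (map_word f u) (map_word f v).
Proof.
elim=> {u v} [u|u v _|v u w _ uv _|u u' v v' _ uu' _ vv'|a e|u v /f_rel] //.
- exact: word_eq_refl.
- exact: word_eq_sym.
- exact: word_eq_trans.
- by rewrite /map_word !map_cat; apply: word_eq_cat.
- exact: word_eq_cancel.
Qed.

Lemma presented_mapE u :
  presented_map (class_of_word relA u) = class_of_word relB (map_word f u).
Proof. by apply/class_of_wordP/word_eq_map/word_eq_repr. Qed.

Lemma presented_mapM : {morph presented_map : x y / (x * y)%g}.
Proof.
move=> x y; rewrite -(class_of_wordK x) -(class_of_wordK y) -class_of_word_cat.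
by rewrite !presented_mapE /map_word map_cat class_of_word_cat.
Qed.

End PresentedMap.

(** * Braid groups and framed braid groups *)

(* Generators are indexed from 0: i : 'I_n.-1 stands for sigma_(i+1), and
   j : 'I_n stands for t_(j+1). *)

Inductive braid_rel (n : nat) : word 'I_n.-1 -> word 'I_n.-1 -> Prop :=
| braid_rel_far (i j : 'I_n.-1) : (i.+1 < j)%N ->
    braid_rel [:: (i, true); (j, true)] [:: (j, true); (i, true)]
| braid_rel_adj (i j : 'I_n.-1) : j = i.+1 :> nat ->
    braid_rel [:: (i, true); (j, true); (i, true)]
              [:: (j, true); (i, true); (j, true)].

Definition braid_group (n : nat) := presented (@braid_rel n).
HB.instance Definition _ n := Group.on (braid_group n).

Definition sigma (n : nat) (i : 'I_n.-1) : braid_group n :=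
  pgen (@braid_rel n) i.

Lemma right_strand_subproof n (i : 'I_n.-1) : (i.+1 < n)%N.
Proof. by rewrite -ltn_predRL. Qed.

Definition left_strand n (i : 'I_n.-1) : 'I_n := widen_ord (leq_pred n) i.
Definition right_strand n (i : 'I_n.-1) : 'I_n :=
  Ordinal (right_strand_subproof i).

Inductive framed_rel (d n : nat) :
    word ('I_n.-1 + 'I_n)%type -> word ('I_n.-1 + 'I_n)%type -> Prop :=
| framed_rel_braid u v : braid_rel u v ->
    framed_rel d (map_word inl u) (map_word inl v)
| framed_rel_comm (j k : 'I_n) :
    framed_rel d [:: (inr j, true); (inr k, true)]
                 [:: (inr k, true); (inr j, true)]
| framed_rel_swap (j : 'I_n) (i : 'I_n.-1) :
    framed_rel d
      [:: (inr j, true); (inl i, true)]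
      [:: (inl i, true);
          (inr (tperm (left_strand i) (right_strand i) j), true)]
| framed_rel_mod (j : 'I_n) : framed_rel d (nseq d (inr j, true)) [::].

Definition framed_group (d n : nat) := presented (@framed_rel d n).
HB.instance Definition _ d n := Group.on (framed_group d n).

Definition framed_sigma d n (i : 'I_n.-1) : framed_group d n :=
  pgen (@framed_rel d n) (inl i).
Definition framed_t d n (j : 'I_n) : framed_group d n :=
  pgen (@framed_rel d n) (inr j).

Definition framed_of_braid d n : braid_group n -> framed_group d n :=
  @presented_map _ _ inl _ _.

Lemma framed_of_braidM d n :
  {morph @framed_of_braid d n : x y / (x * y)%g}.
Proof.
by apply: presented_mapM => u v uv; apply/word_eq_rel/framed_rel_braid.
Qed.

Lemma leq_pred2 m n : (m <= n)%N -> (m.-1 <= n.-1)%N.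
Proof. by case: m n => [|m] [|n]. Qed.

Definition braid_incl m n (mn : (m <= n)%N) : braid_group m -> braid_group n :=
  @presented_map _ _ (widen_ord (leq_pred2 mn)) _ _.

Definition framed_gen_map m n (mn : (m <= n)%N) (a : 'I_m.-1 + 'I_m) :
    ('I_n.-1 + 'I_n)%type :=
  match a with
  | inl i => inl (widen_ord (leq_pred2 mn) i)
  | inr j => inr (widen_ord mn j)
  end.

Definition framed_incl d m n (mn : (m <= n)%N) :
    framed_group d m -> framed_group d n :=
  @presented_map _ _
    (framed_gen_map mn) _ _.

Lemma braid_rel_widen m n (mn : (m <= n)%N) u v : braid_rel u v ->
  braid_rel (map_word (widen_ord (leq_pred2 mn)) u)
            (map_word (widen_ord (leq_pred2 mn)) v).
Proof. by case=> i j ij; constructor. Qed.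

Lemma braid_inclM m n (mn : (m <= n)%N) :
  {morph braid_incl mn : x y / (x * y)%g}.
Proof.
by apply: presented_mapM => u v /(braid_rel_widen mn)/word_eq_rel.
Qed.

Lemma framed_rel_widen d m n (mn : (m <= n)%N) u v : framed_rel d u v ->
  framed_rel d
    (map_word (framed_gen_map mn) u)
    (map_word (framed_gen_map mn) v).
Proof.
case=> {u v} [u v uv|j k|j i|j].
- have := @framed_rel_braid d n _ _ (braid_rel_widen mn uv).
  by rewrite /map_word -!map_comp.
- exact: framed_rel_comm.
- rewrite /=; set w := widen_ord mn.
  have -> : w (tperm (left_strand i) (right_strand i) j) =
     tperm (left_strand (widen_ord (leq_pred2 mn) i))
           (right_strand (widen_ord (leq_pred2 mn) i)) (w j).
    rewrite -[left_strand (widen_ord _ _)](_ : w (left_strand i) = _);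
      last exact: val_inj.
    rewrite -[right_strand (widen_ord _ _)](_ : w (right_strand i) = _);
      last exact: val_inj.
    by rewrite inj_tperm // => x y /(congr1 val) /= /val_inj.
  exact: framed_rel_swap.
- rewrite /map_word map_nseq /=; exact: framed_rel_mod.
Qed.

Lemma framed_inclM d m n (mn : (m <= n)%N) :
  {morph @framed_incl d _ _ mn : x y / (x * y)%g}.
Proof.
by apply: presented_mapM => u v /(framed_rel_widen mn)/word_eq_rel.
Qed.

(** * Group algebras *)

Section GroupAlgebra.
Context (K : comNzRingType) (G : groupType).

Definition group_algebra : Type := monalg.malg G K.
HB.instance Definition _ := GRing.Lmodule.on group_algebra.

Local Notation supp := monalg.msupp.
Local Notation coef x g := (monalg.mcoeff g x).
Local Notation mono c g := (monalg.mkmalgU g c : group_algebra).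
Local Open Scope fset_scope.

Implicit Types (x y : group_algebra).

Definition galg_of (g : G) : group_algebra := mono 1 g.

Definition galg_one : group_algebra := galg_of 1%g.

Definition galg_mul x y : group_algebra :=
  \sum_(g <- supp x) \sum_(h <- supp y) mono (coef x g * coef y h) (g * h)%g.

Lemma galg_mulw (d1 d2 : {fset G}) x y :
  supp x `<=` d1 -> supp y `<=` d2 ->
  galg_mul x y =
  \sum_(g <- d1) \sum_(h <- d2) mono (coef x g * coef y h) (g * h)%g.
Proof.
move=> le_d1 le_d2; rewrite /galg_mul (big_fset_incl _ le_d1) /=.
  apply/eq_bigr=> g _; apply/big_fset_incl => // h _ /monalg.mcoeff_outdom ->.
  by rewrite mulr0 monalg.monalgU0.
move=> g _ /monalg.mcoeff_outdom xg.
by rewrite big1 // => h _; rewrite xg mul0r monalg.monalgU0.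
Qed.

Lemma galg_mulUU c1 c2 g1 g2 :
  galg_mul (mono c1 g1) (mono c2 g2) = mono (c1 * c2) (g1 * g2)%g.
Proof.
rewrite (galg_mulw monalg.msuppU_le monalg.msuppU_le) !big_seq_fset1.
by rewrite !monalg.mcoeffUU.
Qed.

Lemma galg_mulDl : left_distributive galg_mul +%R.
Proof.
move=> x1 x2 y; rewrite (galg_mulw (monalg.msuppD_le _ _) (fsubset_refl _)).
rewrite [galg_mul x1 y](galg_mulw (fsubsetUl _ (supp x2)) (fsubset_refl _)).
rewrite [galg_mul x2 y](galg_mulw (fsubsetUr (supp x1) _) (fsubset_refl _)).
rewrite -big_split /=; apply/eq_bigr => g _.
rewrite -big_split /=; apply/eq_bigr => h _.
by rewrite monalg.mcoeffD mulrDl monalg.monalgUD.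
Qed.

Lemma galg_mulDr : right_distributive galg_mul +%R.
Proof.
move=> y x1 x2; rewrite (galg_mulw (fsubset_refl _) (monalg.msuppD_le _ _)).
rewrite [galg_mul y x1](galg_mulw (fsubset_refl _) (fsubsetUl _ (supp x2))).
rewrite [galg_mul y x2](galg_mulw (fsubset_refl _) (fsubsetUr (supp x1) _)).
rewrite -big_split /=; apply/eq_bigr => g _.
rewrite -big_split /=; apply/eq_bigr => h _.
by rewrite monalg.mcoeffD mulrDr monalg.monalgUD.
Qed.

Lemma galg_mul0 : left_zero 0 galg_mul.
Proof. by move=> x; rewrite /galg_mul monalg.msupp0 big_seq_fset0. Qed.

Lemma galg_mulr0 : right_zero 0 galg_mul.
Proof.
move=> x; rewrite /galg_mul big1 // => g _.
by rewrite monalg.msupp0 big_seq_fset0.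
Qed.

Lemma galgE x : x = \sum_(g <- supp x) mono (coef x g) g.
Proof. exact: monalg.monalgE. Qed.

Lemma galg_mul1 : left_id galg_one galg_mul.
Proof.
move=> x; rewrite (galg_mulw monalg.msuppU_le (fsubset_refl _)).
rewrite big_seq_fset1 [RHS]galgE; apply/eq_bigr => g _.
by rewrite monalg.mcoeffUU mul1r mul1g.
Qed.

Lemma galg_mulr1 : right_id galg_one galg_mul.
Proof.
move=> x; rewrite (galg_mulw (fsubset_refl _) monalg.msuppU_le) [RHS]galgE.
apply/eq_bigr => g _; rewrite big_seq_fset1.
by rewrite monalg.mcoeffUU mulr1 mulg1.
Qed.

Lemma galg_mul_suml (I : Type) (r : seq I) (F : I -> group_algebra) y :
  galg_mul (\sum_(i <- r) F i) y = \sum_(i <- r) galg_mul (F i) y.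
Proof.
exact: (big_morph (galg_mul^~ y) (fun _ _ => galg_mulDl _ _ _) (galg_mul0 _)).
Qed.

Lemma galg_mul_sumr (I : Type) (r : seq I) (F : I -> group_algebra) y :
  galg_mul y (\sum_(i <- r) F i) = \sum_(i <- r) galg_mul y (F i).
Proof.
exact: (big_morph (galg_mul y) (fun _ _ => galg_mulDr _ _ _) (galg_mulr0 _)).
Qed.

Lemma galg_mulA : associative galg_mul.
Proof.
move=> x y z; rewrite (galgE x) !galg_mul_suml; apply/eq_bigr => g _.
rewrite (galgE y) !(galg_mul_suml, galg_mul_sumr); apply/eq_bigr => h _.
rewrite (galgE z) !galg_mul_sumr; apply/eq_bigr => k _.
by rewrite !galg_mulUU mulrA mulgA.
Qed.

Lemma galg_one_neq0 : galg_one != 0.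
Proof.
apply/eqP => /(congr1 (monalg.mcoeff 1%g)) /eqP.
by rewrite monalg.mcoeffUU monalg.mcoeff0 oner_eq0.
Qed.

HB.instance Definition _ := GRing.Zmodule_isNzRing.Build group_algebra
  galg_mulA galg_mul1 galg_mulr1 galg_mulDl galg_mulDr galg_one_neq0.

Lemma galg_scaleU c c' g : c *: mono c' g = mono (c * c') g.
Proof.
apply/monalg.malgP => h; rewrite monalg.mcoeffZ !monalg.mcoeffU.
by case: eqP => _; rewrite ?mulr1n ?mulr0n ?mulr0.
Qed.

Lemma galg_scaleAl c x y : c *: (x * y) = (c *: x) * y.
Proof.
rewrite (galgE x) (galgE y) mulr_suml !scaler_sumr mulr_suml.
apply/eq_bigr => g _; rewrite !mulr_sumr scaler_sumr; apply/eq_bigr => h _.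
rewrite galg_scaleU.
by rewrite [_ * _ in LHS]galg_mulUU [RHS]galg_mulUU galg_scaleU mulrA.
Qed.

HB.instance Definition _ :=
  GRing.Lmodule_isLalgebra.Build K group_algebra galg_scaleAl.

Lemma galg_scaleAr c x y : c *: (x * y) = x * (c *: y).
Proof.
rewrite (galgE x) (galgE y) mulr_suml scaler_sumr [in RHS]mulr_suml.
apply/eq_bigr => g _; rewrite mulr_sumr !scaler_sumr mulr_sumr.
apply/eq_bigr => h _; rewrite galg_scaleU.
by rewrite [_ * _ in LHS]galg_mulUU [RHS]galg_mulUU galg_scaleU mulrCA.
Qed.

HB.instance Definition _ :=
  GRing.Lalgebra_isAlgebra.Build K group_algebra galg_scaleAr.

Lemma galg_ofM : {morph galg_of : g h / (g * h)%g >-> g * h}.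
Proof. by move=> g h; rewrite [RHS]galg_mulUU mulr1. Qed.

Lemma galg_of1 : galg_of 1%g = 1.
Proof. by []. Qed.

End GroupAlgebra.

(* The linear extension of a map of groups. *)
Definition galg_map (K : comNzRingType) (G H : groupType) (f : G -> H)
    (x : group_algebra K G) : group_algebra K H :=
  \sum_(g <- monalg.msupp x) monalg.mcoeff g x *: galg_of K (f g).

(** * The quotient of an algebra by a two-sided ideal *)

Section IdealQuotient.
Context (K : comNzRingType) (A : algType K).

Definition two_sided_ideal (I : set A) : Prop :=
  [/\ I 0, forall x y, I x -> I y -> I (x + y) &
      forall a x b, I x -> I (a * x * b)].

Definition ideal_generated (S : set A) : set A := smallest two_sided_ideal S.

Lemma ideal_generatedP S : two_sided_ideal (ideal_generated S).
Proof.
split=> [|x y Ix Iy|a x b Ix] I IS; have [[I0 ID IM] _] := IS => //.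
- by apply: ID; [apply: Ix | apply: Iy].
- by apply: IM; apply: Ix.
Qed.

Lemma ideal_generated_sub S : S `<=` ideal_generated S.
Proof. by move=> x Sx I [_]; apply. Qed.

Variable S : set A.
Local Notation J := (ideal_generated S).

Lemma ideal0 : J 0.
Proof. by case: (ideal_generatedP S). Qed.

Lemma idealD x y : J x -> J y -> J (x + y).
Proof. by case: (ideal_generatedP S) => _ + _; apply. Qed.

Lemma idealM a x b : J x -> J (a * x * b).
Proof. by case: (ideal_generatedP S) => _ _; apply. Qed.

Lemma idealMl a x : J x -> J (a * x).
Proof. by move=> /(idealM a 1); rewrite mulr1. Qed.

Lemma idealMr x b : J x -> J (x * b).
Proof. by move=> /(idealM 1 b); rewrite mul1r. Qed.

Lemma idealN x : J x -> J (- x).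
Proof. by move=> /(idealMl (-1)); rewrite mulN1r. Qed.

Lemma idealZ c x : J x -> J (c *: x).
Proof. by move=> /(idealMl c%:A); rewrite -scalerAl mul1r. Qed.

Definition ideal_eqb (x y : A) : bool := `[< J (x - y) >].

Lemma ideal_eqb_equiv : equiv_class_of ideal_eqb.
Proof.
split=> [x | x y | y x z].
- by apply/asboolP; rewrite subrr; apply: ideal0.
- by apply/asboolP/asboolP => /idealN; rewrite opprB.
- move=> /asboolP xy /asboolP yz; apply/asboolP.
  by rewrite -(subrKA y); apply: idealD.
Qed.

Canonical ideal_equiv := EquivRelPack ideal_eqb_equiv.

Definition ideal_quotient : Type := {eq_quot ideal_equiv}.
HB.instance Definition _ := Choice.on ideal_quotient.
HB.instance Definition _ := EqQuotient.on ideal_quotient.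

Definition quot_of (x : A) : ideal_quotient := \pi_ideal_quotient x.

Lemma quot_ofP x y : quot_of x = quot_of y <-> J (x - y).
Proof.
split; first by move/eqquotP => /asboolP.
by move=> xy; apply/eqquotP/asboolP.
Qed.

Lemma quot_ofK x : quot_of (repr x) = x.
Proof. exact: reprK. Qed.

Lemma quot_repr x : J (repr (quot_of x) - x).
Proof. by apply/quot_ofP; rewrite quot_ofK. Qed.

Definition quot_add (x y : ideal_quotient) := quot_of (repr x + repr y).
Definition quot_opp (x : ideal_quotient) := quot_of (- repr x).
Definition quot_mul (x y : ideal_quotient) := quot_of (repr x * repr y).
Definition quot_scale c (x : ideal_quotient) := quot_of (c *: repr x).

Lemma quot_addE x y : quot_add (quot_of x) (quot_of y) = quot_of (x + y).
Proof.
by apply/quot_ofP; rewrite opprD addrACA; apply: idealD; apply: quot_repr.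
Qed.

Lemma quot_oppE x : quot_opp (quot_of x) = quot_of (- x).
Proof. by apply/quot_ofP; rewrite -opprD; apply: idealN; apply: quot_repr. Qed.

Lemma quot_mulE x y : quot_mul (quot_of x) (quot_of y) = quot_of (x * y).
Proof.
apply/quot_ofP; set x' := repr _; set y' := repr _.
rewrite -(subrKA (x' * y)) -mulrBr -mulrBl.
by apply: idealD; [apply: idealMl | apply: idealMr]; apply: quot_repr.
Qed.

Lemma quot_scaleE c x : quot_scale c (quot_of x) = quot_of (c *: x).
Proof. by apply/quot_ofP; rewrite -scalerBr; apply: idealZ; apply: quot_repr. Qed.

Lemma quot_addA : associative quot_add.
Proof.
move=> x y z; rewrite -(quot_ofK x) -(quot_ofK y) -(quot_ofK z) !quot_addE.
by rewrite addrA.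
Qed.

Lemma quot_addC : commutative quot_add.
Proof. by move=> x y; rewrite /quot_add addrC. Qed.

Lemma quot_add0 : left_id (quot_of 0) quot_add.
Proof. by move=> x; rewrite -(quot_ofK x) quot_addE add0r. Qed.

Lemma quot_addN : left_inverse (quot_of 0) quot_opp quot_add.
Proof. by move=> x; rewrite -(quot_ofK x) quot_oppE quot_addE addNr. Qed.

HB.instance Definition _ := GRing.isZmodule.Build ideal_quotient
  quot_addA quot_addC quot_add0 quot_addN.

Lemma quot_mulA : associative quot_mul.
Proof.
move=> x y z; rewrite -(quot_ofK x) -(quot_ofK y) -(quot_ofK z) !quot_mulE.
by rewrite mulrA.
Qed.

Lemma quot_mul1 : left_id (quot_of 1) quot_mul.
Proof. by move=> x; rewrite -(quot_ofK x) quot_mulE mul1r. Qed.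

Lemma quot_mulr1 : right_id (quot_of 1) quot_mul.
Proof. by move=> x; rewrite -(quot_ofK x) quot_mulE mulr1. Qed.

Lemma quot_mulDl : left_distributive quot_mul quot_add.
Proof.
move=> x y z; rewrite -(quot_ofK x) -(quot_ofK y) -(quot_ofK z).
by rewrite !(quot_mulE, quot_addE) mulrDl.
Qed.

Lemma quot_mulDr : right_distributive quot_mul quot_add.
Proof.
move=> x y z; rewrite -(quot_ofK x) -(quot_ofK y) -(quot_ofK z).
by rewrite !(quot_mulE, quot_addE) mulrDr.
Qed.

HB.instance Definition _ := GRing.Zmodule_isPzRing.Build ideal_quotient
  quot_mulA quot_mul1 quot_mulr1 quot_mulDl quot_mulDr.

Lemma quot_ofD : {morph quot_of : x y / x + y}.
Proof. by move=> x y; rewrite -quot_addE. Qed.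

Lemma quot_ofM : {morph quot_of : x y / x * y}.
Proof. by move=> x y; rewrite -quot_mulE. Qed.

Lemma quot_scaleA a b x :
  quot_scale a (quot_scale b x) = quot_scale (a * b) x.
Proof. by rewrite -(quot_ofK x) !quot_scaleE scalerA. Qed.

Lemma quot_scale1 : left_id 1 quot_scale.
Proof. by move=> x; rewrite -(quot_ofK x) quot_scaleE scale1r. Qed.

Lemma quot_scaleDr : right_distributive quot_scale +%R.
Proof.
move=> a x y; rewrite -(quot_ofK x) -(quot_ofK y) -quot_ofD !quot_scaleE.
by rewrite scalerDr quot_ofD.
Qed.

Lemma quot_scaleDl x : {morph quot_scale^~ x : a b / a + b}.
Proof.
by move=> a b; rewrite -(quot_ofK x) !quot_scaleE scalerDl quot_ofD.
Qed.

HB.instance Definition _ := GRing.Zmodule_isLmodule.Build K ideal_quotient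
  quot_scaleA quot_scale1 quot_scaleDr quot_scaleDl.

Lemma quot_ofZ c x : quot_of (c *: x) = c *: quot_of x.
Proof. by rewrite -quot_scaleE. Qed.

Lemma quot_scaleAl c (x y : ideal_quotient) : c *: (x * y) = (c *: x) * y.
Proof.
rewrite -(quot_ofK x) -(quot_ofK y).
by rewrite -quot_ofM -!quot_ofZ -quot_ofM scalerAl.
Qed.

Lemma quot_scaleAr c (x y : ideal_quotient) : c *: (x * y) = x * (c *: y).
Proof.
rewrite -(quot_ofK x) -(quot_ofK y).
by rewrite -quot_ofM -!quot_ofZ -quot_ofM scalerAr.
Qed.

End IdealQuotient.

Definition quot_map (K : comNzRingType) (A B : algType K) (S : set A)
    (T : set B) (f : A -> B) (x : ideal_quotient S) : ideal_quotient T :=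
  quot_of T (f (repr x)).

Section GroupAlgebraMap.
Context (K : comNzRingType) (G H : groupType) (f : G -> H).
Hypothesis fM : {morph f : x y / (x * y)%g}.

Local Notation F := (@galg_map K G H f).

Lemma galg_mapw (s : {fset G}) (x : group_algebra K G) :
  (monalg.msupp x `<=` s)%fset ->
  F x = \sum_(g <- s) monalg.mcoeff g x *: galg_of K (f g).
Proof.
move=> xs; rewrite /galg_map; apply/big_fset_incl => // g _.
by move/monalg.mcoeff_outdom => ->; rewrite scale0r.
Qed.

Lemma galg_mapD : {morph F : x y / x + y}.
Proof.
move=> x y; rewrite (galg_mapw (monalg.msuppD_le x y)).
rewrite (galg_mapw (fsubsetUl _ (monalg.msupp y))).
rewrite (galg_mapw (fsubsetUr (monalg.msupp x) _)) -big_split /=.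
by apply: eq_bigr => g _; rewrite monalg.mcoeffD scalerDl.
Qed.

Lemma galg_mapZ c x : F (c *: x) = c *: F x.
Proof.
rewrite (galg_mapw (monalg.msuppZ_le c x)) /galg_map scaler_sumr.
by apply: eq_bigr => g _; rewrite monalg.mcoeffZ scalerA.
Qed.

Lemma galg_mapB : {morph F : x y / x - y}.
Proof. by move=> x y; rewrite galg_mapD -!scaleN1r galg_mapZ. Qed.

Lemma galg_map0 : F 0 = 0.
Proof. by rewrite -(scale0r 0) galg_mapZ scale0r. Qed.

Lemma galg_map_of g : F (galg_of K g) = galg_of K (f g).
Proof.
rewrite (galg_mapw monalg.msuppU_le) big_seq_fset1 monalg.mcoeffUU.
by rewrite scale1r.
Qed.

Lemma galg_map1 : F 1 = 1.
Proof.
rewrite -[1]galg_of1 galg_map_of -galg_of1; congr galg_of.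
by apply: (@mulgI H (f 1%g)); rewrite -fM !mulg1.
Qed.

Lemma galg_map_sum (I : Type) (r : seq I) (E : I -> group_algebra K G) :
  F (\sum_(i <- r) E i) = \sum_(i <- r) F (E i).
Proof. exact: (big_morph F galg_mapD galg_map0). Qed.

Lemma galg_gE (x : group_algebra K G) :
  x = \sum_(g <- monalg.msupp x) monalg.mcoeff g x *: galg_of K g.
Proof.
by rewrite {1}[x]galgE; apply: eq_bigr => g _; rewrite galg_scaleU mulr1.
Qed.

Lemma galg_mapM : {morph F : x y / x * y}.
Proof.
have mapU c d g h : F ((c *: galg_of K g) * (d *: galg_of K h)) =
    F (c *: galg_of K g) * F (d *: galg_of K h).
  rewrite -scalerAl -scalerAr -galg_ofM !galg_mapZ !galg_map_of fM galg_ofM.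
  by rewrite -scalerAl -scalerAr.
move=> x y; rewrite (galg_gE x) mulr_suml !galg_map_sum mulr_suml.
apply: eq_bigr => g _; rewrite (galg_gE y); set a := _ *: _.
rewrite mulr_sumr (galg_map_sum _ (fun h => a * _)).
rewrite (galg_map_sum _ (fun h => monalg.mcoeff h y *: _)) mulr_sumr.
by apply: eq_bigr => h _; apply: mapU.
Qed.

Lemma galg_mapX n : {morph F : x / x ^+ n}.
Proof.
elim: n => [|n IHn] x; first by rewrite !expr0 galg_map1.
by rewrite !exprS galg_mapM IHn.
Qed.

End GroupAlgebraMap.

Lemma quot_mapE (K : comNzRingType) (A B : algType K) (S : set A) (T : set B)
    (f : A -> B) :
  f 0 = 0 -> {morph f : x y / x + y} -> {morph f : x y / x - y} ->
  {morph f : x y / x * y} -> (forall x, S x -> ideal_generated T (f x)) ->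
  forall x, quot_map T f (quot_of S x) = quot_of T (f x).
Proof.
move=> f0 fD fB fM ST x; apply/quot_ofP; rewrite -fB.
have I : two_sided_ideal (f @^-1` ideal_generated T).
  by split=> [|a b|a y b] /=; rewrite ?f0 ?fD ?fM;
    [exact: ideal0 | exact: idealD | exact: idealM].
exact: (smallest_sub I ST (quot_repr (S := S) x)).
Qed.

(** * Yokonuma-Hecke algebras *)

Section YokonumaHecke.
Context (K : fieldType) (d n : nat) (q : K).

Local Notation CF := (group_algebra K (framed_group d n)).

Definition framed_idempotent (i : 'I_n.-1) : CF :=
  d%:R^-1 *: \sum_(1 <= s < d.+1)
    galg_of K ((framed_t d (left_strand i) ^+ s) *
               (framed_t d (right_strand i) ^- s))%g.

Definition quadratic_relator (i : 'I_n.-1) : CF :=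
  let s := galg_of K (framed_sigma d i) in
  s ^+ 2 - 1 - (q - q^-1) *: (framed_idempotent i * s).

Definition yokonuma_hecke := ideal_quotient (range quadratic_relator).
HB.instance Definition _ := GRing.PzRing.on yokonuma_hecke.
HB.instance Definition _ := GRing.Lmodule.on yokonuma_hecke.

Definition yh_of_framed (f : framed_group d n) : yokonuma_hecke :=
  quot_of _ (galg_of K f).

Definition yh_g (i : 'I_n.-1) : yokonuma_hecke :=
  yh_of_framed (framed_sigma d i).

Definition yh_t (j : 'I_n) : yokonuma_hecke := yh_of_framed (framed_t d j).

Definition yh_of_braid (a : braid_group n) : yokonuma_hecke :=
  yh_of_framed (framed_of_braid d a).

End YokonumaHecke.

Lemma relator_morph (K : fieldType) (A B : algType K) (f : A -> B) :
  {morph f : x y / x - y} -> {morph f : x y / x * y} -> f 1 = 1 ->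
  (forall c x, f (c *: x) = c *: f x) ->
  forall (s e : A) (c : K),
    f (s ^+ 2 - 1 - c *: (e * s)) = f s ^+ 2 - 1 - c *: (f e * f s).
Proof. by move=> fB fM f1 fZ s e c; rewrite !expr2 !fB fZ !fM f1. Qed.

Definition yh_incl (K : fieldType) d m n (q : K) (mn : (m <= n)%N) :
    yokonuma_hecke d m q -> yokonuma_hecke d n q :=
  quot_map _ (galg_map (framed_incl mn)).

Lemma yh_inclE (K : fieldType) d m n (q : K) (mn : (m <= n)%N) x :
  yh_incl mn (quot_of (range (quadratic_relator d q)) x) =
  quot_of (range (quadratic_relator d q)) (galg_map (framed_incl mn) x).
Proof.
have fM := @framed_inclM d m n mn.
have fX k : {morph @framed_incl d m n mn : x / (x ^+ k)%g}.
  elim: k => [|k IHk] g; last by rewrite !expgS fM IHk.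
  by apply: (@mulgI _ (framed_incl mn g)); rewrite !expg0 -fM !mulg1.
have fV : {morph @framed_incl d m n mn : x / (x^-1)%g}.
  move=> g; apply: (@mulgI _ (framed_incl mn g)).
  rewrite -fM !mulgV; exact: (fX 0%N 1%g).
apply: quot_mapE.
- exact: galg_map0.
- exact: galg_mapD.
- exact: galg_mapB.
- exact: galg_mapM.
move=> _ [i _ <-]; apply: ideal_generated_sub.
pose i' := widen_ord (leq_pred2 mn) i; exists i' => //.
have incl_gen a : framed_incl mn (pgen (@framed_rel d m) a) =
    pgen (@framed_rel d n) (framed_gen_map mn a).
  rewrite /framed_incl /pgen presented_mapE // => u v.
  by move/(framed_rel_widen mn)/word_eq_rel.
have incl_t (j : 'I_m) : framed_incl mn (framed_t d j) =
    framed_t d (widen_ord mn j) := incl_gen (inr j).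
have incl_e : galg_map (framed_incl mn) (framed_idempotent K d i) =
    framed_idempotent K d i'.
  rewrite /framed_idempotent galg_mapZ (galg_map_sum _ _ (fun s : nat => _)).
  rewrite (_ : left_strand i' = widen_ord mn (left_strand i)); last exact: val_inj.
  rewrite (_ : right_strand i' = widen_ord mn (right_strand i));
    last exact: val_inj.
  rewrite -!incl_t; move: (framed_t d (left_strand i)) => tl.
  move: (framed_t d (right_strand i)) => tr; congr (_ *: _).
  by apply: eq_bigr => s _; rewrite galg_map_of fM fV !fX.
have -> := relator_morph (galg_mapB _) (galg_mapM fM) (galg_map1 _ fM)
  (galg_mapZ _).
by rewrite incl_e galg_map_of (incl_gen (inl i)).
Qed.

(** * The Juyumaya trace *)

(* Polynomials in z, x_1, ..., x_(d-1): the variable 0 is z, and the variable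
   k + 1 is x_(k+1). *)
Definition trace_ring (K : fieldType) (d : nat) := mpoly d.-1.+1 K.
HB.instance Definition _ (K : fieldType) d :=
  GRing.ComUnitRing.on (trace_ring K d).
HB.instance Definition _ (K : fieldType) d := GRing.Lmodule.on (trace_ring K d).

Definition z_var (K : fieldType) d : trace_ring K d := mpolyX K (mnm1 ord0).
Definition x_var (K : fieldType) d (k : 'I_d.-1) : trace_ring K d :=
  mpolyX K (mnm1 (lift ord0 k)).

(* A function on the union of the algebras is a family of functions that is
   compatible with the inclusions.  Such a trace exists and is unique. *)
Record juyumaya_trace (K : fieldType) (d : nat) (q : K)
    (tr : forall n, yokonuma_hecke d n q -> trace_ring K d) : Prop := {
  trace_linear : forall n c (a b : yokonuma_hecke d n q),
    tr n (c *: a + b) = c *: tr n a + tr n b;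
  trace_incl : forall n (a : yokonuma_hecke d n q),
    tr n.+1 (yh_incl (leqnSn n) a) = tr n a;
  trace_comm : forall n (a b : yokonuma_hecke d n q), tr n (a * b) = tr n (b * a);
  trace1 : forall n, tr n 1 = 1;
  trace_g : forall n (a : yokonuma_hecke d n.+1 q),
    tr n.+2 (yh_incl (leqnSn n.+1) a * @yh_g K d n.+2 q ord_max) =
    z_var K d * tr n.+1 a;
  trace_t : forall n (a : yokonuma_hecke d n q) (k : 'I_d.-1),
    tr n.+1 (yh_incl (leqnSn n) a * @yh_t K d n.+1 q ord_max ^+ k.+1) =
    x_var K k * tr n a
}.

Section SpecializedTrace.
Context (R : realType) (d : nat).

(* exp(2 pi r sqrt(-1)) *)
Definition expi2pi (r : R) : R[i] := Complex (cos (2 * pi * r)) (sin (2 * pi * r)).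

(* The value of x_k in the solution of the E-system attached to the non-empty
   subset D of Z/dZ.  The residues mod d are represented by 'I_d, because 'Z_d
   is not Z/dZ for d = 1. *)

Definition E_solution (D : {set 'I_d}) (k : nat) : R[i] :=
  #|D|%:R^-1 * \sum_(m in D) expi2pi ((k * m)%:R / d%:R).

Definition specialize (D : {set 'I_d}) (p : trace_ring R[i] d) : {poly R[i]} :=
  mmap (@polyC R[i])
    (fun v : 'I_d.-1.+1 =>
       if unlift ord0 v is Some k then (E_solution D k.+1)%:P else 'X)
    p.

Definition specialized_trace (q : R[i])
    (tr : forall n, yokonuma_hecke d n q -> trace_ring R[i] d)
    (D : {set 'I_d}) n (a : yokonuma_hecke d n q) : {poly R[i]} :=
  specialize D (tr n a).

End SpecializedTrace.

(** * Links *)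

Section Links.
Context (R : realType).

Local Notation E := 'rV[R]_3.

Definition point3 (x y z : R) : E := \row_(k < 3) [:: x; y; z]`_k.

(* Closed curves in space, given by 1-periodic parametrizations, which carry
   the orientation. *)
Record curves := Curves { ncomp : nat; curve : 'I_ncomp -> R -> E }.

Definition embedded (L : curves) : Prop :=
  [/\ forall i, continuous (@curve L i),
      forall i s, @curve L i (s + 1) = @curve L i s &
      forall i j s t, @curve L i s = @curve L j t ->
        i = j /\ exists k : int, s - t = k%:~R].

Definition ambient_isotopy (H : R -> E -> E) : Prop :=
  exists G : R -> E -> E,
    [/\ {within `[0, 1] `*` setT, continuous (fun p : R * E => H p.1 p.2)},
        {within `[0, 1] `*` setT, continuous (fun p : R * E => G p.1 p.2)},
        forall t, 0 <= t <= 1 -> cancel (H t) (G t) /\ cancel (G t) (H t) &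
        forall x, H 0 x = x].

(* Isotopy of oriented links: the components may be permuted, and each of them
   reparametrized by an increasing function. *)
Definition isotopic (L M : curves) : Prop :=
  exists2 H, ambient_isotopy H &
  exists2 f : 'I_(ncomp L) -> 'I_(ncomp M), bijective f &
  forall i, exists phi : R -> R,
    [/\ continuous phi, {homo phi : s t / s < t} &
        forall s, H 1 (@curve L i s) = @curve M (f i) (phi s)].

Definition polygonal (L : curves) : Prop :=
  exists2 N : nat, (0 < N)%N &
  forall (i : 'I_(ncomp L)) (k : nat) (u : R), 0 <= u <= 1 ->
    @curve L i ((k%:R + u) / N%:R) =
    (1 - u) *: @curve L i (k%:R / N%:R) + u *: @curve L i (k.+1%:R / N%:R).

(* Tameness is part of the definition of a link. *)
Record link := Link {
  link_curves :> curves;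
  link_embedded : embedded link_curves;
  link_tame : exists P, [/\ embedded P, polygonal P & isotopic link_curves P]
}.

Definition unknot (U : link) : Prop :=
  exists O : link, [/\ isotopic U O, ncomp O = 1%N &
    forall (i : 'I_(ncomp O)) s,
      @curve O i s = point3 (cos (2 * pi * s)) (sin (2 * pi * s)) 0].

(* L is the split union of the M j: after isotopies, the M j lie in pairwise
   disjoint balls, and L is their union.  The norm of E is the sup norm, so
   that the balls are open cubes. *)
Definition split_union (m : nat) (M : 'I_m -> link) (L : link) : Prop :=
  exists (L' : link) (M' : 'I_m -> link) (c : 'I_m -> E) (r : 'I_m -> R)
         (e : {j : 'I_m & 'I_(ncomp (M' j))} -> 'I_(ncomp L')),
    [/\ isotopic L L' /\ (forall j, isotopic (M j) (M' j)),
        forall j i s, ball (c j) (r j) (@curve (M' j) i s),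
        forall j k, j != k -> ball (c j) (r j) `&` ball (c k) (r k) = set0,
        bijective e &
        forall j i s, @curve L' (e (Tagged _ i)) s = @curve (M' j) i s].

Definition split_union_with_unknots (M : link) (k : nat) (L : link) : Prop :=
  exists2 U : 'I_k -> link, forall j, unknot (U j) &
  split_union (fun j : 'I_k.+1 => if unlift ord0 j is Some j' then U j' else M) L.

(** * Closures of braids *)

(* The position, at time u in [0, 1], of the strand that starts at place j + 1
   in the elementary braid b.  A braid is drawn in the half-plane of the points
   (a, z) with a > 0, and its n places are (1, 0), ..., (n, 0).  The strands
   of a crossing turn around each other by half a turn, and sigma_i gives a
   positive crossing in the closed braid.  None stands for the trivial braid. *)
Definition elementary_strand n (b : option ('I_n.-1 * bool)) (u : R) (j : 'I_n) :
    R * R :=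
  match b with
  | None => (j.+1%:R, 0)
  | Some (i, positive) =>
      let eps : R := if positive then 1 else -1 in
      if j == left_strand i then
        (i%:R + 3 / 2 - cos (pi * u) / 2, eps * sin (pi * u) / 2)
      else if j == right_strand i then
        (i%:R + 3 / 2 + cos (pi * u) / 2, - (eps * sin (pi * u) / 2))
      else (j.+1%:R, 0)
  end.

(* The half-plane at angle 2 pi t around the vertical axis. *)
Definition half_plane (t : R) (p : R * R) : E :=
  point3 (p.1 * cos (2 * pi * t)) (p.1 * sin (2 * pi * t)) p.2.

(* The closed braid drawn from a word: the letters, preceded by a trivial
   braid, are performed one after the other while the half-plane makes one
   turn around the axis. *)
Definition closed_braid n (w : word 'I_n.-1) : set E :=
  [set x | exists (k : nat) (u : R) (j : 'I_n),
     [/\ (k < (size w).+1)%N, 0 <= u <= 1 &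
         x = half_plane ((k%:R + u) / (size w).+1%:R)
               (elementary_strand (nth None (None :: map Some w) k) u j)]].

(* The closed braid is oriented by the direction of rotation. *)
Definition parametrizes_closed_braid n (w : word 'I_n.-1) (L : link) : Prop :=
  [set x | exists i s, x = @curve L i s] = closed_braid w /\
  forall i, exists (theta : R -> R) (p : R -> R * R),
    [/\ continuous theta, {homo theta : s t / s < t} &
        forall s, 0 < (p s).1 /\ @curve L i s = half_plane (theta s) (p s)].

Definition braid_closure n (a : braid_group n) (L : link) : Prop :=
  exists w : word 'I_n.-1, class_of_word (@braid_rel n) w = a /\
  exists2 K : link, parametrizes_closed_braid w K & isotopic L K.

End Links.

(** * The decomposition of a braid *)

Definition group_set (G : groupType) (H : set G) : Prop :=
  [/\ H 1%g, forall x y, H x -> H y -> H (x * y)%g & forall x, H x -> H (x^-1)%g].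

Definition subgroup_generated (G : groupType) (S : set G) : set G :=
  smallest (@group_set G) S.

Definition cut_points (m n : nat) (i : nat -> nat) : Prop :=
  [/\ i 0%N = 0%N, (1 <= i 1%N)%N,
      forall j, (1 <= j < m)%N -> (1 < i j.+1 - i j)%N & i m = n].

Lemma cut_points_le m n i : cut_points m n i ->
  forall j : 'I_m, (i j.+1 <= n)%N.
Proof.
move=> [i0 _ step <-] j; have incr k : (k < m)%N -> (i k <= i k.+1)%N.
  case: k => [|k] km; first by rewrite i0.
  by have := step k.+1 km; rewrite ltn_subRL addn1 => /ltnW/ltnW.
case: j => j /=; elim: {-2}m (leqnn m) => [//|k IHk] km.
rewrite ltnS leq_eqVlt => /orP[/eqP -> //|jk].
exact: leq_trans (IHk (ltnW km) jk) (incr _ km).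
Qed.

(* Main.v *)
From HB Require Import structures.
Require Import Defs.
From mathcomp Require Import all_boot all_order all_algebra.
From mathcomp Require Import all_classical all_reals all_analysis.
From mathcomp Require Import complex perm.
From mathcomp Require Import (canonicals) monalg.
From mathcomp Require Import -(notations) mpoly.

(** Include [Y_m] into [Y_n] as the algebra of the first m strands, and let
    [upper m n] be the subalgebra of [Y_n] generated by the g_k and the t_j that
    involve only the strands after the m-th.  The theorem rests on the identity

      tr (a x) = tr a * tr x    for a in [Y_m] and x in [upper m n]

    ([trace_mul_upper]), proved by induction on n, removing the last strand.
    Let g and t be the generators of [Y_(n+1)] that involve the last strand.
    Then [upper m n.+1] is spanned by the elements u t^s and u g v with u and v
    in [upper m n] ([upper_top_span]), and a commutes with u and v
    ([incl_upperC]).  The Markov rules give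

      tr (a u t^s) = c_s tr (a u),
      tr (a u g v) = tr (v a u g) = z tr (v a u) = z tr (a v u),

    and the induction hypothesis takes tr a out of the right-hand sides.  When
    n = m there is nothing above the first m strands: x is a scalar.

    That the elements u t^s and u g v span [upper m n.+1] means that their span
    is stable under left multiplication by the generators.  The only hard case
    is that of g u g.  By induction on n, u is a combination of elements
    u' t'^s and u' h v', where h and t' are the generators attached to the
    previous strand and where u' and v' do not involve it; u' and v' commute
    with g, so that the quadratic relation deals with g t'^s g = g^2 t^s and
    the braid relation with g h g = h g h ([top_span_sandwich]).

    A braid in the subgroup generated by the sigma_k, k >= m, is mapped into
    [upper m n]; for the inverse generators this is the formula
    g^-1 = g - (q - q^-1) e ([upper_braid]).  So the identity splits off the
    factors of the product of braids one after the other ([trace_braid_prod]).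
    The specialized trace is the composite of the trace and a morphism of
    rings, and thus inherits the factorization. *)

Set Implicit Arguments.
Unset Strict Implicit.
Unset Printing Implicit Defensive.

Import GRing.Theory Num.Theory.
Local Open Scope classical_set_scope.
Local Open Scope ring_scope.

(** * Linear subspaces *)

Section LinearSets.
Context (K : fieldType).
Implicit Types V W : lmodType K.

Definition linear_set V (P : set V) : Prop :=
  P 0 /\ forall c x y, P x -> P y -> P (c *: x + y).

Inductive linear_span V (S : set V) : V -> Prop :=
| span_sub x : S x -> linear_span S x
| span0 : linear_span S 0
| spanP c x y : linear_span S x -> linear_span S y -> linear_span S (c *: x + y).

Lemma linear_spanP V (S : set V) : linear_set (linear_span S).
Proof. by split=> [|c x y]; [exact: span0 | exact: spanP]. Qed.

Lemma linear_span_min V (S P : set V) :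
  linear_set P -> S `<=` P -> linear_span S `<=` P.
Proof.
move=> [P0 PD] SP x; elim=> {x} [x /SP //|//|c x y _ Px _ Py]; exact: PD.
Qed.

Lemma linear_setD V (P : set V) x y :
  linear_set P -> P x -> P y -> P (x + y).
Proof. by case=> _ PD Px Py; rewrite -[x]scale1r; apply: PD. Qed.

Lemma linear_setZ V (P : set V) c x : linear_set P -> P x -> P (c *: x).
Proof. by case=> P0 PD Px; rewrite -[_ *: _]addr0; apply: PD. Qed.

Lemma linear_set_sum V (P : set V) (I : Type) (r : seq I) (F : I -> V) :
  linear_set P -> (forall i, P (F i)) -> P (\sum_(i <- r) F i).
Proof.
move=> PL PF; apply: big_ind => [||i _]; [by case: PL | | exact: PF].
by move=> x y; apply: linear_setD.
Qed.

Lemma linear_set_preimage V W (f : V -> W) (P : set W) :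
  (forall c, {morph f : x y / c *: x + y}) ->
  linear_set P -> linear_set (f @^-1` P).
Proof.
move=> fL [P0 PD]; split=> [|c x y] /=; last by rewrite fL; apply: PD.
by have := fL (-1) 0 0; rewrite scaleN1r addNr scaleN1r addNr => ->.
Qed.

Lemma linear_set_equalizer V W (f g : V -> W) :
  (forall c, {morph f : x y / c *: x + y}) ->
  (forall c, {morph g : x y / c *: x + y}) ->
  linear_set [set x | f x = g x].
Proof.
move=> fL gL; split=> [|c x y /= xE yE]; last by rewrite fL gL xE yE.
by have := fL (-1) 0 0; have := gL (-1) 0 0;
  rewrite /= scaleN1r addNr !scaleN1r !addNr => -> ->.
Qed.

End LinearSets.

Section AlgebraTheory.
Context (K : fieldType) (A : algType K).
Implicit Types a b h x y : A.

Lemma lmul_linear a c : {morph (fun x => a * x) : x y / c *: x + y}.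
Proof. by move=> x y; rewrite mulrDr -scalerAr. Qed.

Lemma rmul_linear a c : {morph (fun x => x * a) : x y / c *: x + y}.
Proof. by move=> x y; rewrite mulrDl -scalerAl. Qed.

Lemma exp_intertwine a b h k : a * h = h * b -> a ^+ k * h = h * b ^+ k.
Proof.
move=> ahb; elim: k => [|k IHk]; first by rewrite !expr0 mulr1 mul1r.
by rewrite exprSr -mulrA ahb mulrA IHk -mulrA -exprSr.
Qed.

End AlgebraTheory.

(** * Towers of Yokonuma-Hecke type *)

(** The relations that the factorization of the trace depends on.  In the
    quadratic relation, t^(-s) is written t^((d - 1) s), because the structure
    does not include inverses of the t_j. *)
Record yokonuma_tower (K : fieldType) (d : nat) (q : K)
    (A : nat -> algType K)
    (g : forall n, 'I_n.-1 -> A n) (t : forall n, 'I_n -> A n)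
    (incl : forall m n, (m <= n)%N -> A m -> A n) : Prop := {
  tower_inclP : forall m n (mn : (m <= n)%N) c,
    {morph incl m n mn : x y / c *: x + y};
  tower_inclM : forall m n (mn : (m <= n)%N), {morph incl m n mn : x y / x * y};
  tower_incl1 : forall m n (mn : (m <= n)%N), incl m n mn 1 = 1;
  tower_incl_refl : forall n (nn : (n <= n)%N) x, incl n n nn x = x;
  tower_incl_comp : forall m n p (mn : (m <= n)%N) (np : (n <= p)%N)
    (mp : (m <= p)%N) x, incl n p np (incl m n mn x) = incl m p mp x;
  tower_incl_g : forall m n (mn : (m <= n)%N) (i : 'I_m.-1) (j : 'I_n.-1),
    i = j :> nat -> incl m n mn (g m i) = g n j;
  tower_incl_t : forall m n (mn : (m <= n)%N) (i : 'I_m) (j : 'I_n),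
    i = j :> nat -> incl m n mn (t m i) = t n j;
  tower_t_g : forall n (j : 'I_n) (i : 'I_n.-1),
    t n j * g n i = g n i * t n (tperm (left_strand i) (right_strand i) j);
  tower_braid : forall n (i j : 'I_n.-1), j = i.+1 :> nat ->
    g n i * g n j * g n i = g n j * g n i * g n j;
  tower_quadratic : forall n (i : 'I_n.-1),
    g n i * g n i = 1 + (q - q^-1) *: ((d%:R^-1 *: \sum_(1 <= s < d.+1)
      t n (left_strand i) ^+ s * t n (right_strand i) ^+ (d.-1 * s)) * g n i);
  tower_incl_gC : forall m n (mn : (m <= n)%N) (k : 'I_n.-1) (a : A m),
    (m <= k)%N -> incl m n mn a * g n k = g n k * incl m n mn a;
  tower_incl_tC : forall m n (mn : (m <= n)%N) (k : 'I_n) (a : A m),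
    (m <= k)%N -> incl m n mn a * t n k = t n k * incl m n mn a
}.

Section Upper.
Context (K : fieldType) (d : nat) (q : K) (A : nat -> algType K).
Context (g : forall n, 'I_n.-1 -> A n) (t : forall n, 'I_n -> A n).
Context (incl : forall m n, (m <= n)%N -> A m -> A n).
Hypothesis tower : yokonuma_tower d q g t incl.
Arguments g {n}.
Arguments t {n}.
Arguments incl {m n}.

Local Notation up := (incl (leqnSn _)).

(** As the indices start from 0, the g_k and the t_j with indices at least m are
    the generators that involve none of the first m strands. *)
Inductive upper m n : A n -> Prop :=
| upper_g (k : 'I_n.-1) : (m <= k)%N -> upper m (g k)
| upper_t (j : 'I_n) : (m <= j)%N -> upper m (t j)
| upper0 : upper m 0
| upper1 : upper m 1
| upperP c x y : upper m x -> upper m y -> upper m (c *: x + y)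
| upperM x y : upper m x -> upper m y -> upper m (x * y).
Arguments upper : clear implicits.

Lemma upper_linear m n : linear_set (upper m n).
Proof. by split=> [|c x y]; [exact: upper0 | exact: upperP]. Qed.

Lemma upper_min m n (P : set (A n)) :
  linear_set P -> P 1 -> (forall x y, P x -> P y -> P (x * y)) ->
  (forall k : 'I_n.-1, (m <= k)%N -> P (g k)) ->
  (forall j : 'I_n, (m <= j)%N -> P (t j)) -> forall x, upper m n x -> P x.
Proof.
move=> [P0 PD] P1 PM Pg Pt x.
elim=> {x} [k mk|j mj|||c x y _ Px _ Py|x y _ Px _ Py] //.
- exact: Pg mk.
- exact: Pt mj.
- exact: PD Px Py.
- exact: PM Px Py.
Qed.

Lemma upperX m n (x : A n) k : upper m n x -> upper m n (x ^+ k).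
Proof.
move=> Ux; elim: k => [|k IHk]; first by rewrite expr0; apply: upper1.
by rewrite exprS; apply: upperM.
Qed.

Lemma upper_incl m n x : upper m n x -> upper m n.+1 (up x).
Proof.
move: x; apply: upper_min => [||x y Ux Uy|k mk|j mj].
- exact: linear_set_preimage (tower_inclP tower (leqnSn n)) (@upper_linear m n.+1).
- rewrite (tower_incl1 tower); exact: upper1.
- rewrite (tower_inclM tower); exact: upperM Ux Uy.
- rewrite (tower_incl_g tower _ (j := widen_ord (leq_pred2 (leqnSn n)) k)) //.
  exact: upper_g.
- rewrite (tower_incl_t tower _ (j := widen_ord (leqnSn n) j)) //.
  exact: upper_t.
Qed.

(** The commutant of [incl mn a] is a subalgebra, and contains the generators. *)
Lemma incl_upperC m n (mn : (m <= n)%N) (a : A m) (x : A n) :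
  upper m n x -> incl mn a * x = x * incl mn a.
Proof.
move: x; apply: upper_min => [||x y xC yC|k mk|j mj].
- by apply: linear_set_equalizer => c; [exact: lmul_linear | exact: rmul_linear].
- exact: commr1.
- exact: commrM xC yC.
- exact: (tower_incl_gC tower).
- exact: (tower_incl_tC tower).
Qed.

(** * The span of the last strand *)

Lemma left_g n (k : 'I_n.-1) s :
  t (left_strand k) ^+ s * g k = g k * t (right_strand k) ^+ s.
Proof. by apply: exp_intertwine; rewrite (tower_t_g tower) tpermL. Qed.

Lemma right_g n (k : 'I_n.-1) s :
  t (right_strand k) ^+ s * g k = g k * t (left_strand k) ^+ s.
Proof. by apply: exp_intertwine; rewrite (tower_t_g tower) tpermR. Qed.

Lemma up_t_left n (k : 'I_n.+1.-1) : up (t (k : 'I_n)) = t (left_strand k).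
Proof. exact: (tower_incl_t tower). Qed.

Lemma right_strand_max n (k : 'I_n.+1.-1) : k.+1 = n -> right_strand k = ord_max.
Proof. by move=> kn; apply: val_inj. Qed.

Lemma up_tX_comm n (x : A n) s : up x * t ord_max ^+ s = t ord_max ^+ s * up x.
Proof. by apply: incl_upperC; apply: upperX; apply: upper_t. Qed.

Lemma up_tX s n (j : 'I_n) : up (t j ^+ s) = up (t j) ^+ s.
Proof.
elim: s => [|s IHs]; first by rewrite !expr0 (tower_incl1 tower).
by rewrite !exprS (tower_inclM tower) IHs.
Qed.

Section TopSpan.
Context (m : nat).

(** The normal forms with respect to the last strand.  In [TopG], k is
    necessarily the last index; it is a variable constrained by an equation
    because there is no such index when n = 0. *)
Variant top_generator n : set (A n.+1) :=
| TopT x s of upper m n x : top_generator (up x * t ord_max ^+ s)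
| TopG (k : 'I_n.+1.-1) x y of
    k.+1 = n & (m <= k)%N & upper m n x & upper m n y :
    top_generator (up x * g k * up y).

Definition top_span n : set (A n.+1) := linear_span (@top_generator n).
Arguments top_span : clear implicits.

Section Closure.
Context (n : nat).

Lemma top_span_linear : linear_set (top_span n).
Proof. exact: linear_spanP. Qed.

Lemma up_t_comm (x : A n) : up x * t ord_max = t ord_max * up x.
Proof. exact: (up_tX_comm x 1). Qed.

Lemma top_spanT x s : upper m n x -> top_span n (up x * t ord_max ^+ s).
Proof. by move=> Ux; apply: span_sub; apply: TopT. Qed.

Lemma top_spanG (k : 'I_n.+1.-1) x y :
  k.+1 = n -> (m <= k)%N -> upper m n x -> upper m n y ->
  top_span n (up x * g k * up y).
Proof. by move=> *; apply: span_sub; apply: TopG. Qed.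

Lemma top_span_ind (P : set (A n.+1)) : linear_set P ->
  (forall x s, upper m n x -> P (up x * t ord_max ^+ s)) ->
  (forall (k : 'I_n.+1.-1) x y, k.+1 = n -> (m <= k)%N ->
     upper m n x -> upper m n y -> P (up x * g k * up y)) ->
  top_span n `<=` P.
Proof.
move=> PL PT PG; apply: (linear_span_min PL) => _ [x s Ux|k x y kn mk Ux Uy].
  exact: PT.
exact: PG.
Qed.

Lemma top_span1 : top_span n 1.
Proof.
have := top_spanT 0 (@upper1 m n).
by rewrite (tower_incl1 tower) expr0 mulr1.
Qed.

Lemma top_span_lmul u x :
  upper m n u -> top_span n x -> top_span n (up u * x).
Proof.
move=> Uu; move: x; apply: top_span_ind => [|x s Ux|k x y kn mk Ux Uy].
- exact: (linear_set_preimage (lmul_linear _) top_span_linear).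
- rewrite mulrA -(tower_inclM tower); exact: top_spanT (upperM Uu Ux).
- rewrite !mulrA -(tower_inclM tower); exact: top_spanG (upperM Uu Ux) Uy.
Qed.

Lemma top_span_rmul u x :
  upper m n u -> top_span n x -> top_span n (x * up u).
Proof.
move=> Uu; move: x; apply: top_span_ind => [|x s Ux|k x y kn mk Ux Uy].
- exact: (linear_set_preimage (rmul_linear _) top_span_linear).
- rewrite -mulrA -up_tX_comm mulrA -(tower_inclM tower).
  exact: top_spanT (upperM Ux Uu).
- rewrite -mulrA -(tower_inclM tower); exact: top_spanG (upperM Uy Uu).
Qed.

(** The last framing generator passes through u, and the last braid generator
    turns it into the framing generator of the previous strand, which belongs to
    [upper m n]. *)
Lemma top_span_t x : top_span n x -> top_span n (t ord_max * x).
Proof.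
move: x; apply: top_span_ind => [|x s Ux|k x y kn mk Ux Uy].
- exact: (linear_set_preimage (lmul_linear _) top_span_linear).
- rewrite mulrA -up_t_comm -mulrA -exprS; exact: top_spanT.
- have tg : t ord_max * g k = g k * up (t (k : 'I_n)).
    by rewrite -(right_strand_max kn) up_t_left; apply: (right_g k 1).
  rewrite !mulrA -up_t_comm -(mulrA _ _ (g k)) tg mulrA -mulrA.
  rewrite -(tower_inclM tower); apply: top_spanG => //.
  by apply: upperM Uy; apply: upper_t.
Qed.

Lemma top_span_tX s x : top_span n x -> top_span n (t ord_max ^+ s * x).
Proof.
move=> Wx; elim: s => [|s IHs]; first by rewrite expr0 mul1r.
by rewrite exprS -mulrA; apply: top_span_t.
Qed.

End Closure.

(** The hypothesis on u is what the induction of [upper_top_span] provides one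
    strand below.  It writes u in terms of elements of [A n], which commute with
    the last generator of [A n.+2] and can be moved outside of the product. *)
Lemma top_span_sandwich n (u : A n.+1) :
  (m <= n)%N -> top_span n u ->
  top_span n.+1 (g (ord_max : 'I_n.+2.-1) * up u * g (ord_max : 'I_n.+2.-1)).
Proof.
move=> mn; set k : 'I_n.+2.-1 := ord_max.
have kn : k.+1 = n.+1 by [].
have left_up : t (left_strand k) = up (t (ord_max : 'I_n.+1)).
  exact: esym (up_t_left k).
have right_max := right_strand_max kn.
have far (x : A n) : g k * up (up x) = up (up x) * g k.
  rewrite (tower_incl_comp tower _ _ (ltnW (leqnSn n.+1))); symmetry.
  by apply: incl_upperC; apply: upper_g.
(* g t^s, written with the framing generator on its left. *)
have Wt s : top_span n.+1 (t (left_strand k) ^+ s * g k).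
  rewrite left_up -(up_tX s) -[_ * _]mulr1 -(tower_incl1 tower (leqnSn n.+1)).
  by apply: top_spanG (@upper1 m n.+1) => //; apply: upperX; apply: upper_t.
move: u; apply: top_span_ind => [|x s Ux|k' x y k'n mk Ux Uy].
- apply: (@linear_set_preimage _ _ _ (fun u => g k * up u * g k) _ _
    (@top_span_linear n.+1)) => c u v.
  by rewrite (tower_inclP tower) lmul_linear rmul_linear.
- (* g t'^s g = g^2 t^s, with t' on the left strand and t on the right one *)
  rewrite (tower_inclM tower) mulrA far -!mulrA.
  apply: top_span_lmul; first exact: upper_incl.
  rewrite up_tX -left_up left_g mulrA (tower_quadratic tower) mulrDl mul1r.
  apply: linear_setD (@top_span_linear n.+1) _ _.
    rewrite right_max -[_ ^+ s]mul1r -(tower_incl1 tower (leqnSn n.+1)).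
    exact: top_spanT (@upper1 _ _).
  rewrite -scalerAl; apply: linear_setZ (@top_span_linear n.+1) _.
  rewrite -mulrA -left_g -scalerAl.
  apply: linear_setZ (@top_span_linear n.+1) _.
  rewrite mulr_suml; apply: linear_set_sum (@top_span_linear n.+1) _ => r.
  rewrite -mulrA {1}left_up -up_tX right_max.
  apply: top_span_lmul; first by apply: upperX; apply: upper_t.
  by apply: top_span_tX; apply: Wt.
- set h : A n.+2 := up (g k').
  have hgh : g k * h * g k = h * g k * h.
    rewrite /h (tower_incl_g tower _
      (j := (widen_ord (leqnSn n) k' : 'I_n.+2.-1))) //.
    by symmetry; apply: (tower_braid tower); rewrite /= k'n.
  rewrite !(tower_inclM tower) -/h !mulrA far -!mulrA -far.
  rewrite [h * (_ * _)]mulrA [g k * _]mulrA [g k * (h * _)]mulrA hgh.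
  apply: top_span_lmul; first exact: upper_incl.
  apply: top_span_rmul; first exact: upper_incl.
  by apply: top_spanG => //; apply: upper_g.
Qed.

(** On u t^s, the last generator g turns t^s into the power of a framing
    generator of [upper m n]; on u g v, it produces g u g, which is left to the
    hypothesis. *)
Lemma top_span_g n (k : 'I_n.+1.-1) x :
  (forall u, upper m n u -> top_span n (g k * up u * g k)) ->
  k.+1 = n -> (m <= k)%N -> top_span n x -> top_span n (g k * x).
Proof.
move=> sandwich kn mk; move: x.
apply: top_span_ind => [|x s Ux|k' x y k'n _ Ux Uy].
- exact: (linear_set_preimage (lmul_linear _) (@top_span_linear n)).
- rewrite up_tX_comm mulrA -(right_strand_max kn) -left_g -up_t_left -up_tX.
  by apply: top_spanG => //; apply: upperX; apply: upper_t.
- have -> : k' = k by apply: val_inj; apply: succn_inj; rewrite k'n.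
  by rewrite !mulrA; apply: top_span_rmul => //; apply: sandwich.
Qed.

(** The span contains 1, hence it contains the subalgebra as soon as it is
    stable under left multiplication by the generators: those of [A n] are
    covered by [top_span_lmul], and the two others by [top_span_t] and
    [top_span_g]. *)
Lemma upper_top_span_step n :
  (forall k : 'I_n.+1.-1, k.+1 = n -> (m <= k)%N ->
     forall u, upper m n u -> top_span n (g k * up u * g k)) ->
  upper m n.+1 `<=` top_span n.
Proof.
move=> sandwich x Ux.
suff lmul : forall y, top_span n y -> top_span n (x * y).
  by rewrite -[x]mulr1; apply: lmul; apply: top_span1.
move: x Ux; apply: upper_min => [||x y Px Py z Wz|k mk y|j mj y].
- split=> [y _|c x x' Px Px' y Wy].
    by rewrite mul0r; case: (@top_span_linear n).
  rewrite rmul_linear.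
  by case: (@top_span_linear n) => _; apply; [exact: Px | exact: Px'].
- by move=> y; rewrite mul1r.
- by rewrite -mulrA; apply/Px/Py.
- have [kn|kn] := eqVneq k.+1 n; first exact: top_span_g (sandwich _ kn mk) kn mk.
  have kn1 : (k < n.-1)%N by rewrite ltn_predRL ltn_neqAle kn; exact: ltn_ord k.
  rewrite -(tower_incl_g tower (leqnSn n) (i := Ordinal kn1)) //.
  by apply: top_span_lmul; apply: upper_g.
- have [jn|jn] := eqVneq (j : nat) n.
    by have -> : j = ord_max; [apply: val_inj | apply: top_span_t].
  have jn1 : (j < n)%N by rewrite ltn_neqAle jn -ltnS ltn_ord.
  rewrite -(tower_incl_t tower (leqnSn n) (i := Ordinal jn1)) //.
  by apply: top_span_lmul; apply: upper_t.
Qed.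

(** The induction on n supplies the hypothesis on g u g, since u lies in
    [upper m n], to which the statement for n - 1 applies. *)
Lemma upper_top_span n : upper m n.+1 `<=` top_span n.
Proof.
elim: n => [|n IHn]; apply: upper_top_span_step => k kn mk u Uu; first by [].
have km : k = ord_max by apply: val_inj; apply: succn_inj; rewrite kn.
rewrite km; apply: top_span_sandwich; last exact: IHn.
by case: kn => <-.
Qed.

End TopSpan.

(** * Markov traces *)

Section Trace.
Context (S : comAlgType K) (tr : forall n, A n -> S).
Arguments tr {n}.
Hypothesis tr_linear : forall n c, {morph @tr n : x y / c *: x + y}.
Hypothesis trC : forall n (x y : A n), tr (x * y) = tr (y * x).
Hypothesis tr1 : forall n, tr (1 : A n) = 1.
(* For the Juyumaya trace, c is x_(s mod d), with x_0 = 1. *)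
Hypothesis tr_t : forall s, exists c, forall n (x : A n),
  tr (up x * t ord_max ^+ s) = c * tr x.
Hypothesis tr_g : exists z, forall n (x : A n.+1),
  tr (up x * g (ord_max : 'I_n.+2.-1)) = z * tr x.

Lemma tr_up n (x : A n) : tr (up x) = tr x.
Proof.
have [c tr_c] := tr_t 0; have c1 : c = 1.
  have := tr_c 0%N 1; rewrite (tower_incl1 tower) expr0 mul1r !tr1 mulr1.
  exact: esym.
by rewrite -[up x]mulr1 -(expr0 (t ord_max)) tr_c c1 mul1r.
Qed.

Lemma tr_incl m n (mn : (m <= n)%N) (x : A m) : tr (incl mn x) = tr x.
Proof.
elim: n mn => [|n IHn] mn.
  by case: m mn x => [mn x|//]; rewrite (tower_incl_refl tower).
have := mn; rewrite leq_eqVlt => /orP[/eqP mE|mn'].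
  by clear IHn; move: mn x; rewrite mE => mn x; rewrite (tower_incl_refl tower).
by rewrite -(tower_incl_comp tower (mn' : (m <= n)%N) (leqnSn n)) tr_up IHn.
Qed.

(** The trace property brings v to the left of u, where the Markov rule applies
    to the generator that is now on the right. *)
Lemma tr_sandwich : exists z, forall n (k : 'I_n.+1.-1) (u v : A n),
  k.+1 = n -> tr (up u * g k * up v) = z * tr (v * u).
Proof.
have [z tr_z] := tr_g; exists z => -[[]//|n] k u v kn.
have -> : k = ord_max by apply: val_inj; apply: succn_inj; rewrite kn.
by rewrite trC mulrA -(tower_inclM tower) tr_z.
Qed.

(** For m = n, the predicate says nothing but that x is a scalar.  The stated
    property is stable under products, because it holds for every a: it can be
    proved by induction on the predicate, without making the scalar explicit. *)
Lemma trace_mul_upper_diag n (a x : A n) :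
  upper n n x -> tr (a * x) = tr a * tr x.
Proof.
move=> Ux; move: x Ux a; apply: upper_min => [||x y xP yP|k|j].
- split=> [a|c x y xP yP a].
    have tr0 : tr (0 : A n) = 0.
      by have := tr_linear (-1) (0 : A n) 0; rewrite !scaleN1r !addNr.
    by rewrite mulr0 tr0 mulr0.
  by rewrite lmul_linear !tr_linear xP yP lmul_linear.
- by move=> a; rewrite mulr1 tr1 mulr1.
- by move=> a; rewrite mulrA yP xP yP mulrA.
- by move=> nk; have := ltn_ord k; rewrite ltn_predRL ltnNge (leqW nk).
- by move=> nj; have := ltn_ord j; rewrite ltnNge nj.
Qed.

(** Both sides are linear in x, which may therefore be taken of the form u t^s
    or u g v; the Markov rules then remove the last strand. *)
Theorem trace_mul_upper m n (mn : (m <= n)%N) (a : A m) (x : A n) :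
  upper m n x -> tr (incl mn a * x) = tr a * tr x.
Proof.
elim: n mn x => [|n IHn] mn x.
  have /eqP m0 : m == 0%N by rewrite -leqn0.
  by rewrite {1}m0 => Ux; rewrite trace_mul_upper_diag ?tr_incl.
have := mn; rewrite leq_eqVlt => /orP[/eqP mE|mn'].
  by rewrite {1}mE => Ux; rewrite trace_mul_upper_diag ?tr_incl.
have mn1 : (m <= n)%N by [].
rewrite -(tower_incl_comp tower mn1 (leqnSn n)).
move=> /upper_top_span; move: x; apply: top_span_ind => [|x s Ux|k x y kn mk Ux Uy].
- apply: linear_set_equalizer => c x y; first by rewrite lmul_linear tr_linear.
  by rewrite tr_linear lmul_linear.
- have [c tr_c] := tr_t s.
  by rewrite mulrA -(tower_inclM tower) !tr_c IHn // mulrCA.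
- have [z tr_z] := tr_sandwich; rewrite !mulrA -(tower_inclM tower) !tr_z //.
  rewrite mulrA -(incl_upperC mn1 a Uy) -mulrA IHn.
    by rewrite mulrCA.
  exact: upperM.
Qed.

End Trace.
End Upper.

(** * Presented groups and their inclusions *)

(** A word may begin with the inverse of a generator; hence the second of the
    two induction steps. *)
Lemma presented_ind (A : choiceType) (rel : word A -> word A -> Prop)
    (P : presented rel -> Prop) :
  P 1%g -> (forall a x, P x -> P (pgen rel a * x)%g) ->
  (forall a x, P x -> P ((pgen rel a)^-1 * x)%g) -> forall x, P x.
Proof.
move=> P1 Pg PV x; rewrite -(class_of_wordK x).
elim: (repr x) => [//|[a e] w IHw]; rewrite -cat1s class_of_word_cat.
case: e; first exact: Pg.
have -> : class_of_word rel [:: (a, false)] = ((pgen rel a)^-1)%g.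
  by rewrite -[RHS]/(presented_inv (pgen rel a)) presented_invE.
exact: PV.
Qed.

Lemma group_morph1 (G H : groupType) (f : G -> H) :
  {morph f : x y / (x * y)%g} -> f 1%g = 1%g.
Proof. by move=> fM; apply: (@mulgI _ (f 1%g)); rewrite -fM !mulg1. Qed.

Lemma group_morphV (G H : groupType) (f : G -> H) :
  {morph f : x y / (x * y)%g} -> {morph f : x / (x^-1)%g}.
Proof.
move=> fM x; apply: (@mulgI _ (f x)).
by rewrite -fM !mulgV (group_morph1 fM).
Qed.

Lemma framed_incl_gen d m n (mn : (m <= n)%N) (a : 'I_m.-1 + 'I_m) :
  framed_incl mn (pgen (@framed_rel d m) a) =
  pgen (@framed_rel d n) (framed_gen_map mn a).
Proof.
rewrite /framed_incl /pgen presented_mapE // => u v.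
by move/(framed_rel_widen mn)/word_eq_rel.
Qed.

Lemma framed_incl_refl d n (nn : (n <= n)%N) (x : framed_group d n) :
  framed_incl nn x = x.
Proof.
have incl1 := group_morph1 (framed_inclM (d := d) nn).
have gen_id a : framed_gen_map nn a = a.
  by case: a => a /=; congr (_ _); apply: val_inj.
elim/presented_ind: x => [//|a x IHx|a x IHx]; rewrite framed_inclM IHx.
  by rewrite framed_incl_gen gen_id.
by rewrite (group_morphV (framed_inclM (d := d) nn)) framed_incl_gen gen_id.
Qed.

Lemma framed_incl_comp d m n p (mn : (m <= n)%N) (np : (n <= p)%N)
    (mp : (m <= p)%N) (x : framed_group d m) :
  framed_incl np (framed_incl mn x) = framed_incl mp x.
Proof.
have genE a : framed_gen_map np (framed_gen_map mn a) = framed_gen_map mp a.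
  by case: a => a /=; congr (_ _); apply: val_inj.
elim/presented_ind: x => [|a x IHx|a x IHx].
- by rewrite !(group_morph1 (framed_inclM _)).
- by rewrite !framed_inclM IHx !framed_incl_gen genE.
- by rewrite !(framed_inclM, group_morphV (framed_inclM _)) IHx
    !framed_incl_gen genE.
Qed.

Lemma framed_of_braid_gen d n (i : 'I_n.-1) :
  framed_of_braid d (sigma i) = framed_sigma d i.
Proof.
rewrite /framed_of_braid /sigma /pgen presented_mapE // => u v uv.
exact/word_eq_rel/framed_rel_braid.
Qed.

Lemma braid_incl_gen m n (mn : (m <= n)%N) (i : 'I_m.-1) :
  braid_incl mn (sigma i) = sigma (widen_ord (leq_pred2 mn) i).
Proof.
rewrite /braid_incl /sigma /pgen presented_mapE // => u v.
by move/(braid_rel_widen mn)/word_eq_rel.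
Qed.

Lemma framed_of_braid_incl d m n (mn : (m <= n)%N) (x : braid_group m) :
  framed_of_braid d (braid_incl mn x) = framed_incl mn (framed_of_braid d x).
Proof.
have bM := braid_inclM mn; have fM := framed_inclM (d := d) mn.
have oM k := @framed_of_braidM d k.
have gen i : framed_of_braid d (braid_incl mn (pgen (@braid_rel m) i)) =
    framed_incl mn (framed_of_braid d (pgen (@braid_rel m) i)).
  by rewrite braid_incl_gen !framed_of_braid_gen framed_incl_gen.
elim/presented_ind: x => [|i x IHx|i x IHx].
- by rewrite !(group_morph1 bM, group_morph1 fM, group_morph1 (oM _)).
- by rewrite !(bM, fM, oM) IHx gen.
- rewrite !(bM, fM, oM) IHx (group_morphV bM) !(group_morphV (oM _)).
  by rewrite (group_morphV fM) gen.
Qed.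

Lemma braid_incl_comp m n p (mn : (m <= n)%N) (np : (n <= p)%N)
    (mp : (m <= p)%N) (x : braid_group m) :
  braid_incl np (braid_incl mn x) = braid_incl mp x.
Proof.
have genE (a : 'I_m.-1) : widen_ord (leq_pred2 np) (widen_ord (leq_pred2 mn) a)
    = widen_ord (leq_pred2 mp) a by exact: val_inj.
elim/presented_ind: x => [|a x IHx|a x IHx].
- by rewrite !(group_morph1 (braid_inclM _)).
- by rewrite !braid_inclM IHx !braid_incl_gen genE.
- by rewrite !(braid_inclM, group_morphV (braid_inclM _)) IHx
    !braid_incl_gen genE.
Qed.


(** * Yokonuma-Hecke algebras *)

Lemma quot_of0 (K : comNzRingType) (A : algType K) (S : set A) : quot_of S 0 = 0.
Proof. by apply: (addrI (quot_of S 0)); rewrite -quot_ofD !addr0. Qed.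

Lemma quot_of1 (K : comNzRingType) (A : algType K) (S : set A) : quot_of S 1 = 1.
Proof. by []. Qed.

(** Stated for an arbitrary algebra and an arbitrary ideal, where the structures
    of the quotient remain folded. *)
Lemma quot_quadratic (K : comNzRingType) (A : algType K) (S : set A)
    (s e : A) (c : K) :
  ideal_generated S (s ^+ 2 - 1 - c *: (e * s)) ->
  quot_of S s * quot_of S s = 1 + c *: (quot_of S e * quot_of S s).
Proof.
move=> I; rewrite -!quot_ofM -quot_ofZ -(quot_of1 S) -quot_ofD.
by apply/quot_ofP; rewrite opprD addrA -expr2.
Qed.

Section Yokonuma.
Context (K : fieldType) (d : nat) (d_gt0 : (0 < d)%N) (q : K).

Local Notation Y n := (yokonuma_hecke d n q).

Lemma yh_scaleAl n c (x y : Y n) : c *: (x * y) = (c *: x) * y.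
Proof. exact: quot_scaleAl. Qed.

Lemma yh_scaleAr n c (x y : Y n) : c *: (x * y) = x * (c *: y).
Proof. exact: quot_scaleAr. Qed.

Lemma yh_lmulP n (a : Y n) c : {morph (fun x => a * x) : x y / c *: x + y}.
Proof. by move=> x y; rewrite mulrDr -yh_scaleAr. Qed.

Lemma yh_rmulP n (a : Y n) c : {morph (fun x => x * a) : x y / c *: x + y}.
Proof. by move=> x y; rewrite mulrDl -yh_scaleAl. Qed.

Lemma yh_of_framedM n : {morph @yh_of_framed K d n q : x y / (x * y)%g >-> x * y}.
Proof. by move=> x y; rewrite /yh_of_framed galg_ofM quot_ofM. Qed.

Lemma yh_of_framed1 n : @yh_of_framed K d n q 1%g = 1.
Proof. by rewrite /yh_of_framed galg_of1. Qed.

Lemma yh_of_framedX n k (x : framed_group d n) :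
  yh_of_framed q (x ^+ k)%g = yh_of_framed q x ^+ k.
Proof.
elim: k => [|k IHk]; first by rewrite expg0 expr0 yh_of_framed1.
by rewrite expgS exprS yh_of_framedM IHk.
Qed.

Lemma yh_of_braidM n :
  {morph @yh_of_braid K d n q : x y / (x * y)%g >-> x * y}.
Proof. by move=> x y; rewrite /yh_of_braid framed_of_braidM yh_of_framedM. Qed.

Lemma yh_of_braid1 n : @yh_of_braid K d n q 1%g = 1.
Proof. by rewrite /yh_of_braid (group_morph1 (@framed_of_braidM d n)). Qed.

Lemma yh_ind n (P : set (Y n)) :
  linear_set P -> (forall f, P (yh_of_framed q f)) -> forall x, P x.
Proof.
move=> [P0 PD] Pf x; rewrite -(quot_ofK x) (galg_gE (repr x)).
elim: (finmap.enum_fset _) => [|f s IHs]; first by rewrite big_nil quot_of0.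
by rewrite big_cons quot_ofD quot_ofZ; apply: PD; [exact: Pf | exact: IHs].
Qed.

Section Inclusion.
Context (m n : nat) (mn : (m <= n)%N).

Local Notation incl := (yh_incl (K := K) (d := d) (q := q) mn).

Lemma yh_inclP c : {morph incl : x y / c *: x + y}.
Proof.
move=> x y; rewrite -(quot_ofK x) -(quot_ofK y) -quot_ofZ -quot_ofD !yh_inclE.
by rewrite galg_mapD galg_mapZ quot_ofD quot_ofZ.
Qed.

Lemma yh_inclM : {morph incl : x y / x * y}.
Proof.
move=> x y; rewrite -(quot_ofK x) -(quot_ofK y) -quot_ofM !yh_inclE.
by rewrite (galg_mapM (framed_inclM _)) quot_ofM.
Qed.

Lemma yh_incl_framed f : incl (yh_of_framed q f) = yh_of_framed q (framed_incl mn f).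
Proof. by rewrite /yh_of_framed yh_inclE galg_map_of. Qed.

Lemma yh_incl1 : incl 1 = 1.
Proof.
by rewrite -yh_of_framed1 yh_incl_framed (group_morph1 (framed_inclM _)).
Qed.

Lemma yh_incl_g (i : 'I_m.-1) (j : 'I_n.-1) :
  i = j :> nat -> incl (yh_g d q i) = yh_g d q j.
Proof.
move=> ij; rewrite yh_incl_framed framed_incl_gen; congr (yh_of_framed _ _).
by rewrite /framed_sigma; congr (pgen _ (inl _)); apply: val_inj.
Qed.

Lemma yh_incl_t (i : 'I_m) (j : 'I_n) :
  i = j :> nat -> incl (yh_t d q i) = yh_t d q j.
Proof.
move=> ij; rewrite yh_incl_framed framed_incl_gen; congr (yh_of_framed _ _).
by rewrite /framed_t; congr (pgen _ (inr _)); apply: val_inj.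
Qed.

Lemma yh_incl_braid b : incl (yh_of_braid d q b) = yh_of_braid d q (braid_incl mn b).
Proof. by rewrite /yh_of_braid framed_of_braid_incl yh_incl_framed. Qed.

End Inclusion.

Lemma yh_incl_comp m n p (mn : (m <= n)%N) (np : (n <= p)%N)
    (mp : (m <= p)%N) (x : Y m) :
  yh_incl np (yh_incl mn x) = yh_incl mp x.
Proof.
move: x; apply: yh_ind => [|f].
  by apply: linear_set_equalizer => c x y; rewrite !yh_inclP.
by rewrite !yh_incl_framed (framed_incl_comp _ _ mp).
Qed.

Lemma yh_incl_refl n (nn : (n <= n)%N) (x : Y n) : yh_incl nn x = x.
Proof.
move: x; apply: yh_ind => [|f].
  by apply: (@linear_set_equalizer _ _ _ _ id) => // c x y; rewrite yh_inclP.
by rewrite !yh_incl_framed framed_incl_refl.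
Qed.

Lemma framed_relE n u v : framed_rel d (n := n) u v ->
  class_of_word (@framed_rel d n) u = class_of_word _ v.
Proof. by move=> uv; apply/class_of_wordP/word_eq_rel. Qed.

Lemma class_of_word2 (A : choiceType) (rel : word A -> word A -> Prop) a b :
  class_of_word rel [:: (a, true); (b, true)] = (pgen rel a * pgen rel b)%g.
Proof. by rewrite -cat1s class_of_word_cat. Qed.

Lemma class_of_word3 (A : choiceType) (rel : word A -> word A -> Prop) a b c :
  class_of_word rel [:: (a, true); (b, true); (c, true)] =
  (pgen rel a * pgen rel b * pgen rel c)%g.
Proof. by rewrite -mulgA -class_of_word2 -cat1s class_of_word_cat. Qed.

Section Relations.
Context (n : nat).

Local Notation g := (@yh_g K d n q).
Local Notation t := (@yh_t K d n q).

Lemma framed_tC (j k : 'I_n) :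
  (framed_t d j * framed_t d k = framed_t d k * framed_t d j)%g.
Proof. by have /framed_relE := framed_rel_comm d j k; rewrite !class_of_word2. Qed.

Lemma framed_t_sigma (j : 'I_n) (i : 'I_n.-1) :
  (framed_t d j * framed_sigma d i =
   framed_sigma d i * framed_t d (tperm (left_strand i) (right_strand i) j))%g.
Proof. by have /framed_relE := framed_rel_swap d j i; rewrite !class_of_word2. Qed.

Lemma framed_sigmaC (i j : 'I_n.-1) : (i.+1 < j)%N ->
  (framed_sigma d i * framed_sigma d j = framed_sigma d j * framed_sigma d i)%g.
Proof.
move=> ij; have /framed_relE := framed_rel_braid d (braid_rel_far ij).
by rewrite /= !class_of_word2.
Qed.

Lemma framed_t_order (j : 'I_n) : (framed_t d j ^+ d = 1)%g.
Proof.
apply: etrans (framed_relE (framed_rel_mod d j)).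
suff powE k : (framed_t d j ^+ k)%g =
    class_of_word (@framed_rel d n) (nseq k (inr j, true)) by exact: powE.
elim: k => [//|k IHk].
by rewrite expgS IHk -[nseq _.+1 _]cat1s class_of_word_cat.
Qed.

Lemma yh_braid (i j : 'I_n.-1) : j = i.+1 :> nat -> g i * g j * g i = g j * g i * g j.
Proof.
move=> ij; have /framed_relE := framed_rel_braid d (braid_rel_adj ij).
by rewrite /= !class_of_word3 /yh_g -!yh_of_framedM => ->.
Qed.

Lemma yh_t_g (j : 'I_n) (i : 'I_n.-1) :
  t j * g i = g i * t (tperm (left_strand i) (right_strand i) j).
Proof. by rewrite /yh_t /yh_g -!yh_of_framedM framed_t_sigma. Qed.

Lemma yh_t_order (j : 'I_n) : t j ^+ d = 1.
Proof. by rewrite /yh_t -yh_of_framedX framed_t_order yh_of_framed1. Qed.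

Lemma yh_t_mod (j : 'I_n) s : t j ^+ s = t j ^+ (s %% d).
Proof.
by rewrite {1}(divn_eq s d) exprD mulnC exprM yh_t_order expr1n mul1r.
Qed.

Lemma framed_tV (j : 'I_n) : ((framed_t d j)^-1 = framed_t d j ^+ d.-1)%g.
Proof.
by apply: (@mulgI _ (framed_t d j)); rewrite mulgV -expgS prednK ?framed_t_order.
Qed.

Lemma quot_of_sum (A : algType K) (S : set A) (r : seq nat) (F : nat -> A) :
  quot_of S (\sum_(s <- r) F s) = \sum_(s <- r) quot_of S (F s).
Proof.
exact: (big_morph _ (@quot_ofD _ _ _) (quot_of0 _)).
Qed.

Lemma yh_quadratic (i : 'I_n.-1) :
  g i * g i = 1 + (q - q^-1) *: ((d%:R^-1 *: \sum_(1 <= s < d.+1)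
    t (left_strand i) ^+ s * t (right_strand i) ^+ (d.-1 * s)) * g i).
Proof.
set e := _ *: \sum_(_ <= _ < _) _.
have -> : e = quot_of _ (framed_idempotent K d i).
  rewrite /e /framed_idempotent quot_ofZ quot_of_sum; congr (_ *: _).
  apply: eq_bigr => s _; rewrite /yh_t -!yh_of_framedX -yh_of_framedM.
  by rewrite -expVgn framed_tV expgnA.
by apply: quot_quadratic; apply: ideal_generated_sub; exists i.
Qed.

End Relations.
End Yokonuma.

(** * Commutation of distant strands *)

Lemma framed_incl_commute d m n (mn : (m <= n)%N) (h : framed_group d n) :
  (forall a, commute (pgen (@framed_rel d n) (framed_gen_map mn a)) h) ->
  forall f : framed_group d m, commute (framed_incl mn f) h.
Proof.
move=> ha; elim/presented_ind => [|a x IHx|a x IHx].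
- by rewrite (group_morph1 (framed_inclM _)); apply/commute_sym/commute1.
- rewrite framed_inclM framed_incl_gen.
  by apply/commute_sym/commuteM; apply: commute_sym.
- rewrite framed_inclM (group_morphV (framed_inclM _)) framed_incl_gen.
  apply/commute_sym/commuteM; last exact: commute_sym.
  exact/commuteV/commute_sym.
Qed.

Lemma framed_t_sigmaC d n (j : 'I_n) (k : 'I_n.-1) :
  ((j < k) || (k.+1 < j))%N -> commute (framed_t d j) (framed_sigma d k).
Proof.
move=> jk; rewrite /commute framed_t_sigma tpermD //; apply/eqP => /(congr1 val) /=;
  by move=> E; move: jk; rewrite -E ?ltnn ?ltnNge ?leqnSn.
Qed.

Lemma framed_incl_sigmaC d m n (mn : (m <= n)%N) (k : 'I_n.-1)
    (f : framed_group d m) :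
  (m <= k)%N -> commute (framed_incl mn f) (framed_sigma d k).
Proof.
move=> mk; apply: framed_incl_commute => -[i|j].
  apply: framed_sigmaC => /=; apply: leq_trans mk.
  by have := ltn_ord i; rewrite ltn_predRL.
by apply: framed_t_sigmaC; rewrite /= (leq_trans (ltn_ord j)).
Qed.

Lemma framed_incl_tC d m n (mn : (m <= n)%N) (k : 'I_n) (f : framed_group d m) :
  (m <= k)%N -> commute (framed_incl mn f) (framed_t d k).
Proof.
move=> mk; apply: framed_incl_commute => -[i|j]; last exact: framed_tC.
apply/commute_sym/framed_t_sigmaC => /=; apply/orP; right.
by apply: leq_trans mk; have := ltn_ord i; rewrite ltn_predRL.
Qed.

(** * Yokonuma-Hecke algebras as a tower *)

Section YokonumaTower.
Context (K : fieldType) (d : nat) (q : K).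

Local Notation Y n := (yokonuma_hecke d n q).

Lemma yh_incl_commute m n (mn : (m <= n)%N) (h : framed_group d n) :
  (forall f : framed_group d m, commute (framed_incl mn f) h) ->
  forall a : Y m,
    yh_incl mn a * yh_of_framed q h = yh_of_framed q h * yh_incl mn a.
Proof.
move=> hC; apply: yh_ind => [|f].
  apply: linear_set_equalizer => c y z.
    by rewrite yh_inclP yh_rmulP.
  by rewrite yh_inclP yh_lmulP.
by rewrite yh_incl_framed -!yh_of_framedM hC.
Qed.

(** An [algType] is a nonzero ring.  The quotients [Y_n] are nonzero as soon as
    they carry a trace with value 1 at 1, but not by construction: hence the
    argument nz, which occurs in the instances below. *)
Definition nonzero_yh (nz : forall n, (1 : Y n) != 0) (n : nat) : Type := Y n.

Context (nz : forall n, (1 : Y n) != 0).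

HB.instance Definition _ n := GRing.PzRing.on (nonzero_yh nz n).
HB.instance Definition _ n := GRing.Lmodule.on (nonzero_yh nz n).
HB.instance Definition _ n :=
  GRing.PzSemiRing_isNonZero.Build (nonzero_yh nz n) (nz n).
HB.instance Definition _ n :=
  GRing.Lmodule_isLalgebra.Build K (nonzero_yh nz n) (@yh_scaleAl K d q n).
HB.instance Definition _ n :=
  GRing.Lalgebra_isAlgebra.Build K (nonzero_yh nz n) (@yh_scaleAr K d q n).

Definition yh_algebra (n : nat) : algType K := nonzero_yh nz n.
Definition yh_algebra_g n (k : 'I_n.-1) : yh_algebra n := yh_g d q k.
Definition yh_algebra_t n (j : 'I_n) : yh_algebra n := yh_t d q j.
Definition yh_algebra_incl m n (mn : (m <= n)%N) (a : yh_algebra m) :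
  yh_algebra n := yh_incl mn a.

Hypothesis d_gt0 : (0 < d)%N.

Lemma yokonuma_towerP :
  yokonuma_tower d q yh_algebra_g yh_algebra_t yh_algebra_incl.
Proof.
split.
- exact: yh_inclP.
- exact: yh_inclM.
- exact: yh_incl1.
- exact: yh_incl_refl.
- exact: yh_incl_comp.
- exact: yh_incl_g.
- exact: yh_incl_t.
- exact: yh_t_g.
- exact: yh_braid.
- exact: yh_quadratic.
- move=> m n mn k a mk; apply: yh_incl_commute => f; exact: framed_incl_sigmaC.
- move=> m n mn k a mk; apply: yh_incl_commute => f; exact: framed_incl_tC.
Qed.

Local Notation upper m n := (@upper K yh_algebra yh_algebra_g yh_algebra_t m n).

(** By the quadratic relation, g^-1 = g - (q - q^-1) e. *)
Lemma upper_sigmaV m n (k : 'I_n.-1) :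
  (m <= k)%N -> upper m n (yh_of_framed q (framed_sigma d k)^-1%g).
Proof.
move=> mk; pose gV : yh_algebra n := yh_of_framed q (framed_sigma d k)^-1%g.
have ggV : yh_algebra_g k * gV = 1.
  by apply: etrans (esym (yh_of_framedM q _ _)) _; rewrite mulgV yh_of_framed1.
have UL := @upper_linear _ _ yh_algebra_g yh_algebra_t m n.
have := congr1 (fun x => x * gV) (tower_quadratic yokonuma_towerP k).
set e := _ *: \sum_(_ <= _ < _) _.
have Ue : upper m n e.
  apply: (linear_setZ _ UL); apply: (linear_set_sum _ UL) => s.
  by apply: upperM; apply: upperX; apply: upper_t => //=; apply: leqW.
rewrite /= -mulrA ggV mulr1 mulrDl mul1r -scalerAl -mulrA ggV mulr1 => gE.
rewrite -[yh_of_framed _ _]/gV.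
have -> : gV = - (q - q^-1) *: e + yh_algebra_g k.
  by rewrite gE scaleNr [RHS]addrC addrK.
by apply: upperP => //; apply: upper_g.
Qed.

(** The inverse is added to the property so that it defines a subgroup. *)
Lemma upper_braid m n (b : braid_group n) :
  subgroup_generated [set s | exists2 k : 'I_n.-1, (m <= k)%N & s = sigma k] b ->
  upper m n (yh_of_braid d q b).
Proof.
pose P := [set b : braid_group n |
  upper m n (yh_of_braid d q b) /\ upper m n (yh_of_braid d q b^-1%g)].
move=> Gb; suff [] : P b by [].
move: b Gb; apply: smallest_sub.
  split=> [|x y [Ux UVx] [Uy UVy]|x [Ux UVx]]; rewrite /P /=.
  - rewrite invg1 !yh_of_braid1; split; exact: upper1.
  - rewrite invgM !yh_of_braidM.
    by split; [exact: upperM Ux Uy | exact: upperM UVy UVx].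
  - by rewrite invgK.
move=> _ [k mk ->]; split; rewrite /yh_of_braid.
  rewrite framed_of_braid_gen; exact: upper_g.
rewrite (group_morphV (@framed_of_braidM d n)) framed_of_braid_gen.
exact: upper_sigmaV.
Qed.

End YokonumaTower.

(** * Products of braids on consecutive strands *)

Section JuyumayaTrace.
Context (K : fieldType) (d : nat) (d_gt0 : (0 < d)%N) (q : K).
Context (tr : forall n : nat, yokonuma_hecke d n q -> trace_ring K d).
Hypothesis tr_trace : juyumaya_trace tr.

Local Notation Y n := (yokonuma_hecke d n q).

(** Otherwise 1 = tr 1 = tr 0 = 0 in the ring of polynomials. *)
Lemma yh_nonzero n : (1 : Y n) != 0.
Proof.
apply/eqP => Y0; have := trace1 tr_trace n; rewrite Y0 => tr0.
have := trace_linear tr_trace (-1) (0 : Y n) 0; rewrite tr0 scaler0 addr0.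
by rewrite tr0 scaleN1r addNr => /eqP; rewrite oner_eq0.
Qed.

(** Since t^d = 1, the exponent may be reduced modulo d; the value of c is then
    1 or one of the variables x_k. *)
Lemma trace_incl_tX s : exists c, forall n (x : Y n),
  tr (yh_incl (leqnSn n) x * yh_t d q ord_max ^+ s) = c * tr x.
Proof.
case sE : (s %% d)%N (ltn_pmod s d_gt0) => [|k] kd.
  exists 1 => n x; rewrite yh_t_mod sE expr0 mulr1 mul1r.
  exact: (trace_incl tr_trace).
have kd1 : (k < d.-1)%N by rewrite ltn_predRL.
exists (x_var K (Ordinal kd1)) => n x; rewrite yh_t_mod sE.
exact: (trace_t tr_trace x (Ordinal kd1)).
Qed.

Lemma trace_braid_mul m n (mn : (m <= n)%N) (a : braid_group m) (b : braid_group n) :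
  subgroup_generated [set s | exists2 k : 'I_n.-1, (m <= k)%N & s = sigma k] b ->
  tr (yh_of_braid d q (braid_incl mn a * b)%g) =
  tr (yh_of_braid d q a) * tr (yh_of_braid d q b).
Proof.
move=> /(upper_braid yh_nonzero d_gt0) Ub.
rewrite yh_of_braidM -yh_incl_braid.
apply: (@trace_mul_upper K d q _ _ _ _ (yokonuma_towerP yh_nonzero d_gt0)
  (mpoly d.-1.+1 K) tr) Ub.
- move=> k c; exact: (trace_linear tr_trace).
- exact: (trace_comm tr_trace).
- exact: (trace1 tr_trace).
- exact: trace_incl_tX.
- exists (z_var K d); exact: (trace_g tr_trace).
Qed.

Lemma trace_braid_incl m n (mn : (m <= n)%N) (a : braid_group m) :
  tr (yh_of_braid d q (braid_incl mn a)) = tr (yh_of_braid d q a).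
Proof.
rewrite -[braid_incl mn a]mulg1 trace_braid_mul.
  by rewrite yh_of_braid1 (trace1 tr_trace) mulr1.
by move=> H [[H1 _ _] _].
Qed.

(** The product of the first k braids lives on i k strands, and the next braid
    only involves later strands: [trace_braid_mul] splits it off. *)
Lemma trace_braid_prod m n (i : nat -> nat) (i0 : i 0%N = 0%N)
    (i_mono : forall j, (j < m)%N -> (i j <= i j.+1)%N)
    (im : forall j : 'I_m, (i j.+1 <= n)%N) (b : forall j : 'I_m, braid_group (i j.+1)) :
  (forall j : 'I_m, subgroup_generated
    [set s | exists2 k : 'I_(i j.+1).-1, (i j <= k)%N & s = sigma k] (b j)) ->
  tr (yh_of_braid d q (\prod_(j < m) braid_incl (im j) (b j))%g) =
  \prod_(j < m) tr (yh_of_braid d q (b j)).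
Proof.
move=> b_gen.
suff partial k (km : (k <= m)%N) : exists (ikn : (i k <= n)%N) (a : braid_group (i k)),
    braid_incl ikn a =
      (\prod_(j < k) braid_incl (im (widen_ord km j)) (b (widen_ord km j)))%g /\
    tr (yh_of_braid d q a) = \prod_(j < k) tr (yh_of_braid d q (b (widen_ord km j))).
  have [ikn [a [aE tra]]] := partial m (leqnn m).
  have wid (j : 'I_m) : widen_ord (leqnn m) j = j by apply: val_inj.
  apply: etrans (etrans tra _); last by apply: eq_bigr => j _; rewrite wid.
  rewrite -(trace_braid_incl ikn) aE; congr (tr (yh_of_braid d q _)).
  by apply: eq_bigr => j _; rewrite wid.
elim: k km => [|k IHk] km.
  have i0n : (i 0%N <= n)%N by rewrite i0.
  exists i0n, 1%g; rewrite !big_ord0 yh_of_braid1 (trace1 tr_trace).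
  by split=> //; apply: (group_morph1 (braid_inclM _)).
have [ikn [a [aE tra]]] := IHk (ltnW km).
pose l : 'I_m := widen_ord km ord_max.
have widE (j : 'I_k) : widen_ord km (widen_ord (leqnSn k) j) = widen_ord (ltnW km) j.
  exact: val_inj.
exists (im l), (braid_incl (i_mono k km) a * b l)%g; split.
  rewrite big_ord_recr braid_inclM (braid_incl_comp _ _ ikn) aE.
  by congr (_ * _)%g; apply: eq_bigr => j _; rewrite widE.
rewrite big_ord_recr trace_braid_mul; last exact: (b_gen l).
apply: (congr1 ( *%R^~ _)); rewrite tra.
by apply: eq_bigr => j _; rewrite widE.
Qed.

End JuyumayaTrace.

Lemma cut_points_mono m n i : cut_points m n i ->
  forall j, (j < m)%N -> (i j <= i j.+1)%N.
Proof.
move=> [i0 _ step _] [|j] jm; first by rewrite i0.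
by have := step j.+1 jm; rewrite ltn_subRL addn1 => /ltnW/ltnW.
Qed.

Lemma specialize_prod (R : realType) d (D : {set 'I_d}) m
    (F : 'I_m -> trace_ring R[i] d) :
  specialize D (\prod_(j < m) F j) = \prod_(j < m) specialize D (F j).
Proof.
have [specM spec1] := mmap_is_multiplicative (fun v : 'I_d.-1.+1 =>
  if unlift ord0 v is Some k then (E_solution R D k.+1)%:P else 'X)
  (polyC : {rmorphism R[i] -> {poly R[i]}}).
exact: (big_morph (specialize D) specM spec1).
Qed.

Theorem proposition3p3 (R : realType) (d : nat) (d_gt0 : (0 < d)%N)
    (q : R[i]) (q_neq0 : q != 0)
    (tr : forall n : nat, yokonuma_hecke d n q -> trace_ring R[i] d)
    (tr_trace : juyumaya_trace tr)
    (m n : nat) (m_gt0 : (0 < m)%N)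
    (L : link R) (Lj : 'I_m -> link R) (L_split : split_union Lj L)
    (i : nat -> nat) (i_cut : cut_points m n i)
    (alpha : braid_group n) (alphaj : forall j : 'I_m, braid_group (i j.+1))
    (alphaE : alpha =
      (\prod_(j < m) braid_incl (cut_points_le i_cut j) (alphaj j))%g)
    (alpha_closure : braid_closure alpha L)
    (alphaj_gen : forall j : 'I_m,
      subgroup_generated
        [set s | exists2 k : 'I_(i j.+1).-1, (i j <= k)%N & s = sigma k]
        (alphaj j))
    (alphaj_closure : forall j : 'I_m, exists2 Kj : link R,
      braid_closure (alphaj j) Kj & split_union_with_unknots (Lj j) (i j) Kj) :
  tr n (yh_of_braid d q alpha) =
    \prod_(j < m) tr (i j.+1) (yh_of_braid d q (alphaj j)) /\
  (forall D : {set 'I_d}, D != finset.set0 ->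
    specialized_trace tr D (yh_of_braid d q alpha) =
    \prod_(j < m) specialized_trace tr D (yh_of_braid d q (alphaj j))).
Proof.
have i0 : i 0%N = 0%N by case: (i_cut).
have trE : tr n (yh_of_braid d q alpha) =
    \prod_(j < m) tr (i j.+1) (yh_of_braid d q (alphaj j)).
  rewrite alphaE; exact: (trace_braid_prod d_gt0 tr_trace i0
    (cut_points_mono i_cut) _ alphaj_gen).
by split=> // D _; rewrite /specialized_trace trE specialize_prod.
Qed.
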